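(* Let $f:\mathbb{R}\to\mathbb{R}$ be a non-negative, not identically zero, compactly supported absolutely continuous function. Suppose that there exist constants $C_1,C_2$ such that $$K(\varepsilon,f')\le C_1\exp(C_2\varepsilon^{-1/3})\quad\text{for every }\varepsilon>0.$$ Then there exists a measurable set $T\subset\mathbb{R}$ (in fact, a locally finite union of intervals) such that for every $a\ge 1$ the integral $\int_T f\left(\frac{x}{a}+b\right)dx$ is strictly monotone in $b$ ($b\in\mathbb{R}$).
   Context: For an $L^1$ function $h:\mathbb{R}\to\mathbb{R}$ and $\varepsilon>0$ define $$K(\varepsilon,h)=\inf\{\mathrm{Var}(g): g:\mathbb{R}\to\mathbb{R}\text{ is compactly supported},\ \|h-g\|_1<\varepsilon\},$$ where $\mathrm{Var}(g)$ denotes the total variation of $g$ on $\mathbb{R}$ and $\|\cdot\|_1$ is the $L^1(\mathbb{R})$ norm. Here $f'$ is the almost everywhere existing derivative of the absolutely continuous function $f$, an $L^1$ function. Intervals are bounded and nondegenerate; a union of intervals is locally finite if every bounded interval meets only finitely many of them. *)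

(* Defs.v *)
From HB Require Import structures.
From mathcomp Require Import all_boot all_order all_algebra.
From mathcomp Require Import all_classical all_reals all_analysis.

Set Implicit Arguments.
Unset Strict Implicit.
Unset Printing Implicit Defensive.

Import Order.TTheory GRing.Theory Num.Theory.
Import numFieldNormedType.Exports.

Local Open Scope classical_set_scope.
Local Open Scope ring_scope.

Definition abs_continuous (R : realType) (f : R -> R) : Prop :=
  forall e : R, 0 < e -> exists2 d : R, 0 < d &
    forall (n : nat) (a b : 'I_n -> R),
      (forall i, a i <= b i) ->
      trivIset [set: 'I_n] (fun i => `]a i, b i[%classic) ->
      \sum_(i < n) (b i - a i) < d ->
      \sum_(i < n) `|f (b i) - f (a i)| < e.

Definition compactly_supported (R : realType) (f : R -> R) : Prop :=
  compact (closure [set x | f x != 0]).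

Definition total_variation_line (R : realType) (g : R -> R) : \bar R :=
  ereal_sup [set total_variation ab.1 ab.2 g | ab in [set ab : R * R | ab.1 <= ab.2]].

(* Measurability of [g] is required because the library's integral of a
   non-measurable non-negative function is a lower integral, so that [Lnorm]
   would not be the L^1 norm. A function of finite total variation is Borel, so
   this removes only functions whose variation is +oo, and the infimum does not
   change. *)
Definition Kvar (R : realType) (eps : R) (h : R -> R) : \bar R :=
  ereal_inf [set total_variation_line g | g in
    [set g : R -> R | [/\ measurable_fun [set: R] g,
      compactly_supported g &
      (Lnorm lebesgue_measure 1 (EFin \o (h \- g)%R) < eps%:E)%E]]].

Definition bounded_itv (R : realType) (J : set R) : Prop :=
  [/\ is_interval J, bounded_set J & exists x y, [/\ J x, J y & x < y]].

Definition locally_finite_union_itv (R : realType) (T : set R) : Prop :=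
  exists F : set (set R),
    [/\ forall J, F J -> bounded_itv J,
        forall I, bounded_itv I -> finite_set [set J | F J /\ J `&` I !=set0] &
        T = \bigcup_(J in F) J].

(* Main.v *)
Require Import Defs.
From HB Require Import structures.
From mathcomp Require Import all_boot all_order all_algebra.
From mathcomp Require Import unstable all_classical all_reals all_analysis.
From mathcomp Require Import measurable_realfun ring lra zify.

Set Implicit Arguments.
Unset Strict Implicit.
Unset Printing Implicit Defensive.

Import Order.TTheory GRing.Theory Num.Theory.
Import numFieldNormedType.Exports.

Local Open Scope classical_set_scope.
Local Open Scope ring_scope.

(** The set [T] is locally a union of many short blocks whose local density
    increases slowly from 0 to 1 along the line, with slope at least [slope r],
    of order 1 / (r log^2 r), on [[-r, r]].

    If [T] were replaced by its density, the conclusion would be immediate: the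
    integral of [profile x * f (x / a + b)] is that of [profile] against a bump
    which moves to the left as [b] grows, so it decreases
    ([profile_integral_decrease]). The decrease per unit of [b] is at least a
    constant times [a ^ 2 * slope r], where [[-r, r]] contains the bump.

    Replacing the density by [T] costs an error, and the increment of this error
    from [b1] to [b2] is bounded through the derivative of [f]. Write [f'] as [g]
    plus a remainder of L^1 norm less than [e], where [g] has variation at most
    [V e], which is what the bound on [K] provides. Let [G] be a primitive of
    [g]. Then [f - G] has total variation at most [e], and the difference of two
    shifts of [G] by [t] has total variation at most [t * V e]
    ([variation_decomposition]). The first part contributes at most [a * e] per
    unit of [b] ([increment_integral]). The second is integrated against the
    discrepancy between [T] and its density, which has zero mean on each cell of
    the subdivision that defines [T]; hence it contributes at most the mesh
    times [V e] ([discrepancy_estimate]).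

    It remains to choose the mesh ([scale_choice]). A bump of width [a] whose
    distance to the origin is [s] sees a decrease at least of order
    [a / ((1 + s) ^ 3 * (1 + log a) ^ 2)], so [e] may be taken of order
    [(1 + s) ^ -3 * (1 + log a) ^ -2]. The hypothesis then gives
    [V e <= C1 * exp (C * (1 + s) * (1 + log a) ^ (2 / 3))]. As [2 / 3 < 1], this
    grows more slowly than any power of [a], and the dependence on [s] is
    absorbed by a mesh [1 / N s] that shrinks fast enough at infinity.

    The passage from [f'] to [f] requires that an absolutely continuous function
    be the integral of its almost everywhere defined derivative. This is derived
    from the Radon-Nikodym theorem applied to the Stieltjes measures of the
    variation function of [f] and of its difference with [f]
    ([abs_continuous_indefinite_integral]), combined with Lebesgue
    differentiation ([abs_continuous_derive1_ae]). *)

(** * Absolute continuity and total variation *)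

Section AbsoluteContinuity.
Context {R : realType}.
Implicit Types (f : R -> R) (a b x y : R).

Lemma abs_continuous_fin f : abs_continuous f ->
  forall e : R, 0 < e -> exists2 d : R, 0 < d &
    forall (I : finType) (a b : I -> R), (forall i, a i <= b i) ->
      trivIset setT (fun i => `]a i, b i[%classic) ->
      \sum_i (b i - a i) < d -> \sum_i `|f (b i) - f (a i)| < e.
Proof.
move=> acf e e0; have [d d0 fd] := acf e e0; exists d => // I a b ab tab.
have reind (F : I -> R) : \sum_i F i = \sum_(k < #|I|) F (enum_val k).
  by rewrite (reindex (@enum_val I I))//; apply: onW_bij; exact: enum_val_bij.
rewrite !reind; apply: fd => [k|]; first exact: ab.
apply/trivIsetP => i j _ _ ij; move/trivIsetP : tab => /(_ (enum_val i) (enum_val j)).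
by apply => //; apply: contra_neq ij; exact: enum_val_inj.
Qed.

(** Partitions of disjoint intervals cut out disjoint intervals of the same
    total length, to which absolute continuity applies. *)
Lemma abs_continuous_variation f : abs_continuous f ->
  forall e : R, 0 < e -> exists2 d : R, 0 < d &
    forall (n : nat) (a b : 'I_n -> R) (s : 'I_n -> seq R),
      (forall i, itv_partition (a i) (b i) (s i)) ->
      trivIset setT (fun i => `]a i, b i[%classic) ->
      \sum_i (b i - a i) < d -> \sum_i variation (a i) (b i) f (s i) < e.
Proof.
move=> acf e e0; have [d d0 fd] := abs_continuous_fin acf e0.
exists d => // n a b s abs tab abd.
pose p i (j : nat) := nth (b i) (a i :: s i) j.
pose J := {i : 'I_n & 'I_(size (s i))}.
have sum_sig (F : forall i : 'I_n, 'I_(size (s i)) -> R) :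
    \sum_i \sum_j F i j = \sum_(u : J) F (tag u) (tagged u).
  by rewrite sig_big_dep.
have mono i : {in [pred j | (j <= size (s i))%N] &, {homo p i : j k / (j < k)%N >-> j < k}}.
  move=> j k js ks jk; apply: (sorted_ltn_nth lt_trans) => //.
  by case: (abs i).
have lt_step i (j : 'I_(size (s i))) : p i j < p i j.+1.
  by apply: (mono i j j.+1) => //; rewrite inE// ltnW.
have le_p i j k : (j <= k <= size (s i))%N -> p i j <= p i k.
  move=> /andP[]; rewrite leq_eqVlt => /predU1P[->//|jk] ks.
  by apply/ltW/(mono i j k) => //; rewrite inE ltnW// (leq_trans jk).
have -> : \sum_i variation (a i) (b i) f (s i) =
    \sum_(u : J) `|f (p (tag u) (tagged u).+1) - f (p (tag u) (tagged u))|.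
  rewrite -(sum_sig (fun i j => `|f (p i j.+1) - f (p i j)|)).
  by apply: eq_bigr => i _; rewrite /variation big_mkord.
apply: fd => [[i j]/=||]; first exact/ltW/lt_step.
- apply/trivIsetP => -[i j] [i' j'] _ _ /= neq.
  apply/eqP/negPn/negP => /set0P[x []] /=; rewrite !in_itv/= => /andP[x1 x2] /andP[x3 x4].
  have ii' : i = i'.
    apply: (tab i i' Logic.I Logic.I); exists x; split => /=; rewrite in_itv/=.
      rewrite (le_lt_trans _ x1) ?(lt_le_trans x2)//.
        by apply: itv_partition_nth_le => //; rewrite ltnS.
      by apply: itv_partition_nth_ge => //; rewrite ltnS ltnW.
    rewrite (le_lt_trans _ x3) ?(lt_le_trans x4)//.
      by apply: itv_partition_nth_le => //; rewrite ltnS.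
    by apply: itv_partition_nth_ge => //; rewrite ltnS ltnW.
  subst i'; have [jj|jj|jj] := ltngtP j j'.
  + have := le_p i j.+1 j'; rewrite jj ltnW// => /(_ isT) h.
    by have := lt_trans x3 (lt_le_trans x2 h); rewrite ltxx.
  + have := le_p i j'.+1 j; rewrite jj ltnW// => /(_ isT) h.
    by have := lt_trans x1 (lt_le_trans x4 h); rewrite ltxx.
  + by move/eqP: neq; apply; congr existT; exact: val_inj.
- rewrite (le_lt_trans _ abd)// -(sum_sig (fun i j => p i j.+1 - p i j)).
  apply: ler_sum => i _; rewrite -(big_mkord xpredT (fun j => p i j.+1 - p i j)).
  by rewrite telescope_sumr// /p (itv_partition_nth_size _ (abs i)).
Qed.

(** Short intervals carry variation at most 1, and every interval is a finite
    union of short ones. *)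
Lemma abs_continuous_bounded_variation f : abs_continuous f ->
  forall a b, a <= b -> total_variation a b f \is a fin_num.
Proof.
move=> acf; have [d d0 fd] := abs_continuous_variation acf ltr01.
have small a b : a <= b -> b - a < d -> total_variation a b f \is a fin_num.
  move=> ab bad; apply/bounded_variationP => //; exists 1 => _ [s abs <-].
  have := fd 1%N (fun=> a) (fun=> b) (fun=> s) (fun=> abs).
  rewrite !big_ord1 => h; apply/ltW/h => //.
  by move=> i j _ _ _; rewrite !ord1.
(* Steps of length [d / 2] leave a margin in the strict inequality. *)
suff H n a b : a <= b -> b - a < d *+ n.+1 / 2 -> total_variation a b f \is a fin_num.
  move=> a b ab; apply: (H (Num.bound ((b - a) / (d / 2)))) => //.
  rewrite -[d *+ _]mulr_natl -mulrA -ltr_pdivrMr ?divr_gt0//.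
  have q0 : 0 <= (b - a) / (d / 2) by rewrite !divr_ge0// ?subr_ge0// ltW.
  rewrite (lt_le_trans (archi_boundP q0))//.
  by rewrite ler_nat leqnSn.
elim: n a b => [a b ab h|n ih a b ab h].
  by apply: small => //; rewrite (lt_trans h)// mulr1n; lra.
have [lt|ge] := ltP (b - a) d; first exact: small.
have ac : a <= a + d / 2 by lra.
have cb : a + d / 2 <= b by lra.
rewrite (total_variationD f ac cb) fin_numD small//=; last by lra.
by apply: ih => //; move: h; rewrite mulrS; lra.
Qed.

(** The variation of a function from a base point, counted negatively to the
    left of it: one function on the whole line from which the variation on
    every interval is read off. *)
Lemma total_variation_primitive f :
  (forall a b, a <= b -> total_variation a b f \is a fin_num) ->
  exists V : R -> R, forall a b, a <= b -> total_variation a b f = (V b - V a)%:E.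
Proof.
move=> fin.
exists (fun x => if 0 <= x then fine (total_variation 0 x f)
                 else - fine (total_variation x 0 f)) => a b ab.
have tvD x y z : x <= y -> y <= z -> fine (total_variation x z f) =
    fine (total_variation x y f) + fine (total_variation y z f).
  by move=> xy yz; rewrite (total_variationD f xy yz) fineD ?fin.
rewrite -(fineK (fin _ _ ab)); congr EFin.
case: leP => b0; case: leP => a0.
- by rewrite (tvD 0 a b)//; lra.
- by rewrite (tvD a 0 b)//; lra.
- by exfalso; lra.
- by have := tvD a b 0 ab (ltW b0); lra.
Qed.

(** The variation over each interval is approached by a partition; the sums over
    the partitions are controlled together by [abs_continuous_variation]. *)
Lemma abs_continuous_total_variation f V : abs_continuous f ->
  (forall a b, a <= b -> total_variation a b f = (V b - V a)%:E) ->
  abs_continuous V.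
Proof.
move=> acf tvV e e0; have e20 : 0 < e / 2 by lra.
have [d d0 fd] := abs_continuous_variation acf e20; exists d => // n a b ab tab abd.
pose h := e / 2 / n.+1%:R; have h0 : 0 < h by rewrite divr_gt0.
have /boolp.choice[s hs] : forall i, exists s, itv_partition (a i) (b i) s /\
    V (b i) - V (a i) < variation (a i) (b i) f s + h.
  move=> i.
  have fin : ereal_sup [set x%:E | x in variations (a i) (b i) f] \is a fin_num.
    by rewrite -/(total_variation (a i) (b i) f) tvV.
  have [_ [_ [s abs <-] <-] lt] := ub_ereal_sup_adherent h0 fin.
  exists s; split => //; move: lt; rewrite -/(total_variation (a i) (b i) f) tvV//.
  by rewrite -EFinD lte_fin ltrBlDr.
have -> : \sum_i `|V (b i) - V (a i)| = \sum_i (V (b i) - V (a i)).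
  apply: eq_bigr => i _; rewrite ger0_norm//.
  by rewrite -lee_fin -tvV// total_variation_ge0.
apply: (@le_lt_trans _ _ (\sum_i (variation (a i) (b i) f (s i) + h))).
  by apply: ler_sum => i _; exact/ltW/(hs i).2.
rewrite big_split/= [e]splitr; apply: ltr_leD.
  by apply: fd => // i; exact: (hs i).1.
rewrite sumr_const card_ord -[_ *+ n]mulr_natl /h mulrCA ler_piMr ?(ltW e20)//.
by rewrite ler_pdivrMr// mul1r ler_nat.
Qed.

End AbsoluteContinuity.

(** * Densities of absolutely continuous functions *)

Section StieltjesDensity.
Context {R : realType}.
Notation mu := (@lebesgue_measure R).

Lemma abs_continuous_continuous (f : R -> R) : abs_continuous f -> continuous f.
Proof.
move=> acf x; apply/cvgrPdist_lt => e e0; have [d d0 fd] := acf e e0.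
near=> y.
have xyd : `|x - y| < d by near: y; exact: cvgr_dist_lt.
have := fd 1%N (fun=> Num.min x y) (fun=> Num.max x y); rewrite !big_ord1.
have [xy|xy] := leP x y; rewrite ?(minr_idPl (ltW xy)).
  rewrite distrC; apply => //; first by move=> i j _ _ _; rewrite !ord1.
  by rewrite -[ltLHS]ger0_norm ?subr_ge0// distrC.
apply => //; [by move=> _; exact: ltW|by move=> i j _ _ _; rewrite !ord1|].
by rewrite -[ltLHS]ger0_norm ?subr_ge0// ltW.
Unshelve. all: by end_near. Qed.

Lemma lebesgue_stieltjes_itv (P : cumulative R R) (a b : R) : a <= b ->
  lebesgue_stieltjes_measure P `]a, b]%classic = (P b - P a)%:E.
Proof.
move=> ab; rewrite /lebesgue_stieltjes_measure /measure_extension.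
by rewrite measurable_mu_extE//= ?wlength_itv_bnd//; exact: is_ocitv.
Qed.

(** Puts the components of an open set of finite measure into the form that
    absolute continuity speaks about; the empty component becomes [`]0, 0[]. *)
Lemma open_interval_finite (J : set R) : open J -> is_interval J ->
  (mu J < +oo)%E -> exists a b : R, a <= b /\ J = `]a, b[%classic.
Proof.
move=> oJ iJ; have [->|/set0P[z Jz]] := eqVneq J set0.
  by move=> _; exists 0, 0; split => //; rewrite set_itv_ge// bnd_simp ltxx.
have JE := (is_intervalP J).1 iJ; move: JE; rewrite -/(pred_set (Rhull J)).
move: (Rhull J) => [[ba a|[]] [bb b|[]]] JE; rewrite JE ?lebesgue_measure_itv//=.
- move=> _; exists a, b; split.
    move: Jz; rewrite JE /= in_itv/= => /andP[]; move: ba bb {JE} => [] [] /=; lra.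
  by rewrite -[in RHS](interior_itv_bnd _ _ ba bb) -JE; exact/esym/interior_id.
all: by rewrite ?ltry ?ltNyr//; move: Jz; rewrite JE/= in_itv/= ?andbF.
Qed.

(** A Lebesgue-null set lies in an open set of small measure, that is, in a
    disjoint union of intervals of small total length; absolute continuity makes
    the increase of [P] small over any finite number of them. *)
Lemma abs_continuous_dominates (P : cumulative R R) : abs_continuous P ->
  lebesgue_stieltjes_measure P `<< mu.
Proof.
move=> acP; apply/null_content_dominatesP => A mA A0.
pose nu : {measure set (measurableTypeR R) -> \bar R} := lebesgue_stieltjes_measure P.
rewrite -[lebesgue_stieltjes_measure P A]/(nu A).
apply/eqP; rewrite eq_le measure_ge0 andbT.
apply/lee_addgt0Pr => e e0; rewrite add0e.
have [d d0 Pd] := acP e e0.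
have [|U [oU AU]] := lebesgue_regularity_outer mA _ d0; first by rewrite A0.
have mU : measurable U by exact: open_measurable.
move=> Ud; have UdE : (mu U < d%:E)%E.
  by rewrite (measureDI mu mU mA) (setIidr AU) A0 adde0.
apply: (@le_trans _ _ (nu U)); first by rewrite le_measure ?inE.
have := open_disjoint_itv_bigcup oU; have := @open_disjoint_itv_trivIset _ _ oU.
have := @open_disjoint_itv_is_interval _ _ oU; have := @open_disjoint_itv_open _ _ oU.
set I := open_disjoint_itv oU => oI iI tI UI.
have mI i : measurable (I i) by exact: open_measurable.
have IU i : I i `<=` U by rewrite UI; exact: bigcup_sup.
have /boolp.choice[ab abP] : forall i, exists ab : R * R,
    ab.1 <= ab.2 /\ I i = `]ab.1, ab.2[%classic.
  move=> i; have [|a [b [ab abE]]] := open_interval_finite (oI i) (iI i).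
    by apply: le_lt_trans (lt_trans UdE (ltry d)); rewrite le_measure ?inE//; exact: mI.
  by exists (a, b).
rewrite UI measure_semi_bigcup//; last by rewrite -UI.
apply: lime_le; first exact: is_cvg_nneseries.
apply: nearW => n; rewrite big_mkord.
have := Pd n (fun i => (ab i).1) (fun i => (ab i).2).
set S := \sum_(i < n) `|_|; have SE : (\sum_(i < n) nu (I i) <= S%:E)%E.
  rewrite -sumEFin; apply: lee_sum => i _; have [abi ->] := abP i.
  rewrite ger0_norm ?subr_ge0 ?cumulative_is_nondecreasing//.
  rewrite -lebesgue_stieltjes_itv// le_measure ?inE//.
  exact: subset_itv_oo_oc.
move=> Sd; apply: (le_trans SE); rewrite lee_fin; apply/ltW/Sd.
- by move=> i; exact: (abP i).1.
- move=> i j _ _ /=; rewrite -(abP i).2 -(abP j).2 => ij.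
  by apply: val_inj; exact: tI.
- rewrite -lte_fin (le_lt_trans _ UdE)// -sumEFin.
  apply: (@le_trans _ _ (\sum_(0 <= i < n) mu (I i))%E).
    rewrite big_mkord; apply: lee_sum => i _; have [abi ->] := abP i.
    by rewrite lebesgue_measure_itv/= lte_fin; case: ltP => [_|]; rewrite -?EFinD ?lee_fin ?subr_le0.
  rewrite UI measure_semi_bigcup//; last by rewrite -UI.
  exact: nneseries_lim_ge.
Qed.

End StieltjesDensity.

Section IndefiniteIntegral.
Context {R : realType}.
Notation mu := (@lebesgue_measure R).

Lemma abs_continuousB (f g : R -> R) :
  abs_continuous f -> abs_continuous g -> abs_continuous (fun x => f x - g x).
Proof.
move=> acf acg e e0; have e20 : 0 < e / 2 by lra.
have [d d0 fd] := acf _ e20; have [d' d'0 gd] := acg _ e20.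
exists (Num.min d d') => [|n a b ab tab]; first by rewrite lt_min d0.
rewrite lt_min => /andP[abd abd']; rewrite [e]splitr.
apply: le_lt_trans (ltrD (fd n a b ab tab abd) (gd n a b ab tab abd')).
rewrite -big_split; apply: ler_sum => i _ /=.
have -> : f (b i) - g (b i) - (f (a i) - g (a i)) =
  (f (b i) - f (a i)) - (g (b i) - g (a i)) by ring.
exact: ler_normB.
Qed.

(** The Radon-Nikodym theorem needs a finite measure, hence the restriction of
    the Stieltjes measure of [P] to [`]A, B]]. *)
Lemma nondecreasing_abs_continuous_density (P : R -> R) (A B : R) : A <= B ->
  {homo P : x y / x <= y} -> abs_continuous P ->
  exists h : R -> R, mu.-integrable setT (EFin \o h) /\
    forall x y, A <= x -> x <= y -> y <= B ->
      P y - P x = \int[mu]_(t in `]x, y]) h t.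
Proof.
move=> AB ndP acP.
have rcP : right_continuous P.
  by apply: right_continuousW; exact: abs_continuous_continuous.
pose Pc : cumulative R R := HB.pack P (isCumulative.Build R _ R P ndP rcP).
pose nu : {measure set (measurableTypeR R) -> \bar R} := lebesgue_stieltjes_measure Pc.
have nuE x y : x <= y -> nu `]x, y]%classic = (P y - P x)%:E.
  exact: (lebesgue_stieltjes_itv Pc).
have mAB : measurable (`]A, B]%classic : set (measurableTypeR R)).
  exact: measurable_itv.
have nuAB : (nu `]A, B]%classic < +oo)%E by rewrite nuE// ltry.
pose nu' : {finite_measure set (measurableTypeR R) -> \bar R} :=
  mfrestr mAB nuAB.
have dom : nu' `<< mu.
  have /null_content_dominatesP Pmu := @abs_continuous_dominates _ Pc acP.
  apply/null_content_dominatesP => E mE E0.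
  rewrite /nu'/= /mfrestr /mrestr; apply: (subset_measure0 _ _ (@subIsetl _ _ _)) => //.
    by apply: measurableI => //; exact: measurable_itv.
  exact: Pmu.
have [k [k0 kfin ik kE]] := radon_nikodym_sigma_finite dom.
exists (fine \o k); split.
  by apply: eq_integrable ik => // x _ /=; rewrite fineK.
move=> x y Ax xy yB.
apply: EFin_inj; rewrite /Rintegral fineK; last first.
  apply: integrable_fin_num; first exact: measurable_itv.
  apply: (integrableS measurableT) => //.
  by apply: eq_integrable ik => // z _ /=; rewrite fineK.
under eq_integral => z _ do rewrite /= fineK//.
rewrite -kE; last exact: measurable_itv.
rewrite /nu'/= /mfrestr /mrestr setIidl -?nuE//.
by move=> z /=; rewrite !in_itv/= => /andP[? ?]; lra.
Qed.

Lemma compactly_supported_itv (f : R -> R) : compactly_supported f ->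
  exists2 L : R, 0 < L & forall x, L <= `|x| -> f x = 0.
Proof.
move=> cf; have [M [_ Mf]] := compact_bounded cf.
exists (`|M| + 1); first by rewrite ltr_wpDl.
move=> x Mx; apply/eqP/negPn/negP => fx.
have : `|x| <= `|M| + 2^-1.
  apply: Mf; last exact: subset_closure.
  by rewrite (le_lt_trans (ler_norm M))// ltrDl.
lra.
Qed.

(** An absolutely continuous function is the difference of its variation
    function and of a second nondecreasing absolutely continuous function; both
    are the distribution functions of measures dominated by the Lebesgue
    measure, so the Radon-Nikodym theorem provides densities. *)
Lemma abs_continuous_indefinite_integral (f : R -> R) :
  compactly_supported f -> abs_continuous f ->
  exists h : R -> R, mu.-integrable setT (EFin \o h) /\
    forall x, f x = \int[mu]_(t in `]-oo, x]) h t.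
Proof.
move=> cf acf; have [L L0 fL] := compactly_supported_itv cf.
have [V VE] := total_variation_primitive (abs_continuous_bounded_variation acf).
have acV := abs_continuous_total_variation acf VE.
have fV x y : x <= y -> `|f y - f x| <= V y - V x.
  by move=> xy; rewrite -lee_fin -VE// total_variation_ge.
have ndV : {homo V : x y / x <= y}.
  by move=> x y /fV h; rewrite -subr_ge0 (le_trans _ h).
have ndVf : {homo (fun x => V x - f x) : x y / x <= y}.
  by move=> x y /fV; rewrite ler_norml => /andP[_]; lra.
have LL : - L <= L by lra.
have [h1 [ih1 h1E]] := nondecreasing_abs_continuous_density LL ndV acV.
have [h2 [ih2 h2E]] := nondecreasing_abs_continuous_density LL ndVf (abs_continuousB acV acf).
pose h x := h1 x - h2 x.
have ih : mu.-integrable setT (EFin \o h).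
  by apply: eq_integrable (integrableB measurableT ih1 ih2).
have mD : measurable (`]- L, L] : set R) by exact: measurable_itv.
exists (h \_ `]- L, L]); split.
  rewrite -restrict_EFin -integrable_mkcond//.
  exact: (integrableS measurableT).
have fE x : - L <= x -> x <= L -> f x = \int[mu]_(t in `]- L, x]) h t.
  move=> Lx xL; have iS (k : R -> R) : mu.-integrable setT (EFin \o k) ->
      mu.-integrable `]- L, x] (EFin \o k).
    by apply: integrableS => //; exact: measurable_itv.
  rewrite RintegralB//; [|exact: iS|exact: iS].
  rewrite -h1E// -h2E// (fL (- L)); first by lra.
  by rewrite normrN ger0_norm// ltW.
move=> x; rewrite -Rintegral_mkcondr.
have [xL|Lx] := leP x (- L).
  rewrite fL; last by rewrite ler0_norm; lra.
  rewrite (_ : _ `&` _ = set0) ?Rintegral_set0//.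
  by apply/seteqP; split => // z [/=]; rewrite !in_itv/= => ? /andP[? ?]; lra.
have [xL|xL] := leP x L.
  rewrite fE// ?ltW//; congr (Rintegral _ _ _); apply/seteqP; split => z /=;
  by rewrite !in_itv/=; lra.
rewrite fL; last by rewrite ger0_norm; lra.
have <- : f L = 0 by rewrite fL// ger0_norm// ltW.
rewrite fE//; congr (Rintegral _ _ _).
by apply/seteqP; split => z /=; rewrite !in_itv/=; lra.
Qed.

Lemma abs_continuous_derive1_ae (f h : R -> R) :
  mu.-integrable setT (EFin \o h) ->
  (forall x, f x = \int[mu]_(t in `]-oo, x]) h t) ->
  {ae mu, forall x, derive1 f x = h x}.
Proof.
move=> ih fE; have -> : f = (fun x => \int[mu]_(t in `]-oo, x]) h t) by apply/funext.
have ihx y : mu.-integrable `]-oo, y] (EFin \o h).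
  by apply: (integrableS measurableT) => //; exact: measurable_itv.
have := FTC1Ny ihx (open_integrable_locally openT ih).
apply: filterS; first exact: (ae_filter_ringOfSetsType mu).
by move=> x [].
Qed.

End IndefiniteIntegral.

(** * Approximation of increments by functions of bounded variation *)

Section Translation.
Context {R : realType}.
Notation mu := (@lebesgue_measure R).
Implicit Types (u : R -> R) (c : R) (D : set R).

Lemma measurable_shift c : measurable_fun setT (fun x : R => x + c).
Proof. exact: measurable_funD. Qed.

Lemma preimage_shift (b0 b1 : bool) (a b c : R) :
  (fun x : R => x + c) @^-1` [set` Interval (BSide b0 a) (BSide b1 b)] =
  [set` Interval (BSide b0 (a - c)) (BSide b1 (b - c))].
Proof.
apply/seteqP; split => x /=; rewrite !itv_boundlr; move: b0 b1 => [] [];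
  rewrite !bnd_simp => /andP[? ?]; apply/andP; split; lra.
Qed.

Lemma lebesgue_measure_shift c D : measurable D ->
  pushforward mu (fun x : R => x + c : measurableTypeR R) D = mu D.
Proof.
move=> mD; apply/esym/lebesgue_measure_unique => //=.
  exact: measurable_shift.
move=> mf _ [[a b]] _ <-.
rewrite /pushforward preimage_shift !lebesgue_measure_itv/= !lte_fin ltrD2r.
by case: ifP => // _; rewrite -!EFinB; congr EFin; ring.
Qed.

Lemma Rintegral_shift u c D : measurable D -> measurable_fun setT u ->
  mu.-integrable ((fun x => x + c) @^-1` D) (EFin \o u \o (fun x => x + c)) ->
  \int[mu]_(x in D) u x = \int[mu]_(x in (fun x => x + c) @^-1` D) u (x + c).
Proof.
move=> mD mfu iu; rewrite /Rintegral; congr fine.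
have mu' : measurable_fun setT (EFin \o u) by exact/measurable_EFinP.
transitivity (\int[pushforward mu (fun x : R => (x + c)%R : measurableTypeR R)]_(x in D) (EFin \o u) x)%E.
  apply: eq_measure_integral => [|mf A mA _]; first exact: measurable_shift.
  by apply/esym; exact: lebesgue_measure_shift.
have h := @integral_pushforward _ _ (measurableTypeR R) (measurableTypeR R) R (fun x : R => x + c : measurableTypeR R)
  (measurable_shift c) mu D _ mu' iu mD.
exact: h.
Qed.

End Translation.

(** [controlled c u]: on every interval, [u] oscillates at most as much as some
    nondecreasing function whose total increase is at most [c]; equivalently,
    the total variation of [u] is at most [c]. *)
Definition controlled {R : realType} (c : R) (u : R -> R) :=
  exists U : R -> R, forall x y, x <= y ->
    `|u y - u x| <= U y - U x /\ U y - U x <= c.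

Section Controlled.
Context {R : realType}.
Notation mu := (@lebesgue_measure R).

Lemma controlled_measurable (c : R) (u : R -> R) :
  controlled c u -> measurable_fun setT u.
Proof.
move=> [U uU].
have -> : u = U \- (fun x => U x - u x) by apply/funext => x /=; ring.
apply: measurable_funB; apply: nondecreasing_measurable => // x y /uU [h _].
  by rewrite -subr_ge0 (le_trans _ h).
by move: h; rewrite ler_norml => /andP[_]; lra.
Qed.

Lemma bounded_integrable (u : R -> R) (D : set R) (M : R) : measurable D ->
  (mu D < +oo)%E -> measurable_fun setT u -> (forall x, D x -> `|u x| <= M) ->
  mu.-integrable D (EFin \o u).
Proof.
move=> mD Dfin mfu uM; apply: measurable_bounded_integrable => //.
  exact: measurable_funTS.
by exists M; split; [exact: num_real|move=> z Mz x Dx; exact: le_trans (uM _ Dx) (ltW Mz)].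
Qed.

Lemma controlled_bounded (c : R) (u : R -> R) : controlled c u ->
  exists M, forall x, `|u x| <= M.
Proof.
move=> [U uU]; exists (`|u 0| + c) => x; rewrite -lerBlDl.
have [x0|/ltW x0] := leP 0 x; have [h1 h2] := uU _ _ x0.
  by apply: le_trans (le_trans h1 h2); exact: lerB_dist.
by rewrite distrC in h1; apply: le_trans (le_trans h1 h2); exact: lerB_dist.
Qed.

Lemma controlled_integrable (c : R) (u : R -> R) (D : set R) :
  controlled c u -> measurable D -> (mu D < +oo)%E ->
  mu.-integrable D (EFin \o u).
Proof.
move=> cu mD Dfin; have [M uM] := controlled_bounded cu.
exact: bounded_integrable mD Dfin (controlled_measurable cu) (fun x _ => uM x).
Qed.

Lemma controlled_shift (c s : R) (u : R -> R) :
  controlled c u -> controlled c (fun x => u (x + s)).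
Proof. by move=> [U uU]; exists (fun x => U (x + s)) => x y xy; apply: uU; lra. Qed.

Lemma controlled_scale (c s : R) (u : R -> R) : 0 < s ->
  controlled c u -> controlled c (fun x => u (x / s)).
Proof.
move=> s0 [U uU]; exists (fun x => U (x / s)) => x y xy.
by apply: uU; rewrite ler_pM2r// invr_gt0.
Qed.

Lemma lebesgue_itv_lty (b0 b1 : bool) (a b : R) :
  (mu [set` Interval (BSide b0 a) (BSide b1 b)] < +oo)%E.
Proof. by rewrite lebesgue_measure_itv/=; case: ifP; rewrite ?ltry. Qed.

End Controlled.

Section Decomposition.
Context {R : realType}.
Notation mu := (@lebesgue_measure R).

(** Here [k'] stands for a pointwise derivative minus a measurable function. Its
    integral is used in the form of a supremum over the simple functions below
    its absolute value, and these include the simple functions below [`|k x|]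
    restricted to the complement of the exceptional set. *)
Lemma integral_majorant_ae (k k' : R -> R) : measurable_fun setT k ->
  {ae mu, forall x, k' x = k x} ->
  (\int[mu]_x `|(k x)%:E| <= \int[mu]_x `|(k' x)%:E|)%E.
Proof.
move=> mk [N [mN N0 kN]].
rewrite (ge0_negligible_integral mN measurableT _ _ N0)//; last first.
  by apply/measurableT_comp => //; exact/measurable_EFinP.
rewrite integral_mkcond !ge0_integralTE//; last first.
  by move=> x; apply: erestrict_ge0.
apply: ge_ereal_sup => _ [s sk <-]; apply: ereal_sup_ubound.
exists s => // x; apply: (le_trans (sk x)).
rewrite patchE; case: ifPn => [|_]; last exact: (abse_ge0 (k' x)%:E).
rewrite inE => -[_ xN].
by have <- // : k' x = k x; apply: contrapT => kx; apply/xN/kN.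
Qed.

(** [G] is the primitive of [g]. The remainder [f - G] is the primitive of
    [f' - g], so its variation is at most the L^1 norm of [f' - g]; and
    [G (x + t) - G x] is an average over shifts of [g], multiplied by [t], so
    its variation is at most [t] times that of [g]. *)
Lemma variation_decomposition (f h g : R -> R) (e V : R) :
  mu.-integrable setT (EFin \o h) ->
  (forall x, f x = \int[mu]_(t in `]-oo, x]) h t) ->
  measurable_fun setT g -> (total_variation_line g <= V%:E)%E ->
  (Lnorm mu 1 (EFin \o (derive1 f \- g)%R) < e%:E)%E ->
  exists G : R -> R, controlled e (fun x => f x - G x) /\
    forall t, 0 <= t -> controlled (t * V) (fun x => G (x + t) - G x).
Proof.
move=> ih fE mg gV; rewrite Lnorm1 => fg.
have mh : measurable_fun setT h by apply/measurable_EFinP; exact: measurable_int ih.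
pose k x := h x - g x.
have mk : measurable_fun setT k by exact: measurable_funB.
have kle : (\int[mu]_x `|(k x)%:E| < e%:E)%E.
  apply: le_lt_trans fg; apply: integral_majorant_ae => //.
  have := abs_continuous_derive1_ae ih fE.
  apply: filterS; first exact: (ae_filter_ringOfSetsType mu).
  by move=> x fx; rewrite /k -fx.
have ik : mu.-integrable setT (EFin \o k).
  apply/integrableP; split; first exact/measurable_EFinP.
  exact: lt_trans kle (ltry _).
have ig : mu.-integrable setT (EFin \o g).
  by apply: eq_integrable (integrableB measurableT ih ik) => // x _ /=; rewrite -EFinB /k; congr EFin; ring.
have iS (u : R -> R) (i : interval R) : mu.-integrable setT (EFin \o u) ->
    mu.-integrable [set` i] (EFin \o u).
  by apply: integrableS => //; exact: measurable_itv.
pose G x := \int[mu]_(t in `]-oo, x]) g t.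
exists G; split.
  pose W x := \int[mu]_(t in `]-oo, x]) `|k t|.
  have iak : mu.-integrable setT (EFin \o (fun t => `|k t|)) by exact: integrable_norm.
  exists W => x y xy.
  have fG z : f z - G z = \int[mu]_(t in `]-oo, z]) k t.
    rewrite /k RintegralB//; [by rewrite fE|exact: iS|exact: iS].
  rewrite !fG /W !Rintegral_itvB ?bnd_simp//; [|exact: iS|exact: iS].
  split; first by apply: le_normr_Rintegral => //; exact: iS.
  rewrite -lee_fin /Rintegral fineK; last first.
    by apply: integrable_fin_num; [exact: measurable_itv|exact: (iS _ _ iak)].
  apply: le_trans (ltW kle); apply: ge0_subset_integral => //.
  exact: measurable_int iak.
have tvg a b : a <= b -> (total_variation a b g <= V%:E)%E.
  by move=> ab; apply: le_trans gV; apply: ereal_sup_ubound; exists (a, b).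
have [|U UE] := @total_variation_primitive R g.
  move=> a b ab; rewrite ge0_fin_numE ?total_variation_ge0//.
  by rewrite (le_lt_trans (tvg a b ab)) ?ltry.
have gU x y : x <= y -> `|g y - g x| <= U y - U x /\ U y - U x <= V.
  by move=> xy; rewrite -!lee_fin -UE//; split; [exact: total_variation_ge|exact: tvg].
have cg : controlled V g by exists U.
have cU : controlled V U.
  exists U => x y /gU [h1 h2]; split => //; rewrite ger0_norm//.
  exact: le_trans h1.
move=> t t0; have mt : measurable (`]0, t]%classic : set (measurableTypeR R)) by exact: measurable_itv.
have isg (u : R -> R) x : controlled V u ->
    mu.-integrable `]0, t] (EFin \o (fun s => u (s + x))).
  move=> cu; apply: controlled_integrable (controlled_shift x cu) _ _ => //.
  exact: lebesgue_itv_lty.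
have GE x : G (x + t) - G x = \int[mu]_(s in `]0, t]) g (s + x).
  rewrite /G Rintegral_itvB ?bnd_simp ?lerDl//; last exact: iS.
  have pE : (fun s => s + x) @^-1` `]x, (x + t)] = `]0, t]%classic :> set R.
    by rewrite preimage_shift subrr addrC addKr.
  by rewrite (@Rintegral_shift _ _ x) ?pE//; exact: isg.
exists (fun x => \int[mu]_(s in `]0, t]) U (s + x)) => x y xy.
clearbody G; rewrite !GE -(RintegralB mt (isg _ y cg) (isg _ x cg)) -(RintegralB mt (isg _ y cU) (isg _ x cU)).
have iB (u : R -> R) : controlled V u ->
    mu.-integrable `]0, t] (EFin \o (fun s => u (s + y) - u (s + x))).
  move=> cu; have := integrableB mt (isg _ y cu) (isg _ x cu).
  by apply: eq_integrable => // s _ /=; rewrite EFinB.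
have gUs s : `|g (s + y) - g (s + x)| <= U (s + y) - U (s + x) /\
    U (s + y) - U (s + x) <= V by apply: gU; lra.
split.
  apply: (le_trans (le_normr_Rintegral mt (iB _ cg))).
  apply: le_Rintegral => //; [|exact: iB|by move=> s _; exact: (gUs s).1].
  by apply: integrable_norm; exact: iB.
apply: (@le_trans _ _ (\int[mu]_(s in `]0, t]) V)).
  apply: le_Rintegral => //; [exact: iB| |by move=> s _; exact: (gUs s).2].
  apply: (@bounded_integrable _ _ _ `|V|) => //; exact: lebesgue_itv_lty.
have tE : fine (mu `]0, t]%classic) = t.
  rewrite lebesgue_measure_itv/= lte_fin; case: ltP => [_|t0'].
    by rewrite oppr0 adde0.
  by apply/eqP; rewrite eq_le t0 t0'.
by rewrite Rintegral_cst// [fine _]tE mulrC.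
Qed.

End Decomposition.

(** * The density profile *)

Section Profile.
Context {R : realType}.
Implicit Types x y r : R.

(** A lower bound for the slope of [profile] on [[-r, r]], of order
    1 / (r log^2 r). A bounded increasing function cannot have slope of order
    1 / r everywhere. It matters that only logarithmic factors are lost: with a
    loss by a power of [r], the part of [f'] left out of the approximation would
    have to decrease like a power of the scale [a], and the variation of the
    approximation would no longer be small compared with [a]. *)
Definition slope r := (2 * (1 + r) * (1 + ln (1 + r)) ^+ 2)^-1.

Definition profile x :=
  if 0 <= x then 1 - (1 + ln (1 + x))^-1 / 2 else (1 + ln (1 - x))^-1 / 2.

Lemma slope_gt0 r : 0 <= r -> 0 < slope r.
Proof.
move=> r0; have l0 : 0 <= ln (1 + r) by apply: ln_ge0; lra.
by rewrite invr_gt0 mulr_gt0 ?exprn_gt0//; lra.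
Qed.

(** One half of the profile, without the factor 1 / 2: the difference of the
    inverses is the difference of the logarithms over their product, and the
    logarithm has slope at least 1 / (1 + r) here. *)
Lemma inv_ln_slope x y r : 0 <= x -> x <= y -> y <= r ->
  2 * slope r * (y - x) <= (1 + ln (1 + x))^-1 - (1 + ln (1 + y))^-1.
Proof.
move=> x0 xy yr.
have lx : 0 <= ln (1 + x) by apply: ln_ge0; lra.
have lxy : ln (1 + x) <= ln (1 + y) by rewrite ler_ln ?posrE; lra.
have lyr : ln (1 + y) <= ln (1 + r) by rewrite ler_ln ?posrE; lra.
set a := ln (1 + x) in lx lxy *; set b := ln (1 + y) in lxy lyr *.
set l := ln (1 + r) in lyr.
have [r1 y1] : 1 + r != 0 /\ 1 + y != 0 by rewrite !gt_eqF//; lra.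
have [a1 b1 l1] : [/\ 1 + a != 0, 1 + b != 0 & 1 + l != 0] by rewrite !gt_eqF//; lra.
have ab : (y - x) / (1 + r) <= b - a.
  have -> : b - a = - ln ((1 + x) / (1 + y)).
    by rewrite ln_div ?posrE; [rewrite /a /b; ring|lra|lra].
  have -> : (1 + x) / (1 + y) = 1 + (x - y) / (1 + y) by field; rewrite ?r1 ?y1.
  rewrite lerNr (le_trans (le_ln1Dx _))//.
    by rewrite ltr_pdivlMr; lra.
  rewrite -mulNr opprB -subr_ge0.
  have -> : (x - y) / (1 + r) - (x - y) / (1 + y) =
     (y - x) * ((1 + y)^-1 - (1 + r)^-1) by field; rewrite ?r1 ?y1 ?a1 ?b1 ?l1.
  by rewrite mulr_ge0 ?subr_ge0// lef_pV2 ?posrE; lra.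
have -> : (1 + a)^-1 - (1 + b)^-1 = (b - a) * ((1 + a) * (1 + b))^-1.
  by field; rewrite ?r1 ?y1 ?a1 ?b1 ?l1.
have -> : 2 * slope r * (y - x) = (y - x) / (1 + r) * ((1 + l) ^+ 2)^-1.
  by rewrite /slope -/l; field; rewrite ?r1 ?y1 ?a1 ?b1 ?l1.
apply: ler_pM => //.
- by rewrite divr_ge0; lra.
- by rewrite invr_ge0 exprn_ge0; lra.
- rewrite lef_pV2 ?posrE ?exprn_gt0 ?mulr_gt0; try lra.
  by rewrite expr2 ler_pM; lra.
Qed.

Lemma profile_gt0 x : 0 < profile x.
Proof.
rewrite /profile; case: (leP 0 x) => x0; have l0 : 0 <= ln (1 + `|x|) by
  (apply: ln_ge0; have := normr_ge0 x; lra).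
  rewrite ger0_norm// in l0; have : (1 + ln (1 + x))^-1 <= 1.
    by rewrite invf_le1; lra.
  by move: (_^-1) => i; lra.
by rewrite ltr0_norm// in l0; rewrite divr_gt0// invr_gt0; lra.
Qed.

Lemma profile_lt1 x : profile x < 1.
Proof.
rewrite /profile; case: (leP 0 x) => x0; have l0 : 0 <= ln (1 + `|x|) by
  (apply: ln_ge0; have := normr_ge0 x; lra).
  by rewrite ger0_norm// in l0; rewrite ltrBlDr ltrDl divr_gt0// invr_gt0; lra.
rewrite ltr0_norm// in l0; have : (1 + ln (1 - x))^-1 <= 1.
  by rewrite invf_le1; lra.
by move: (_^-1) => i; lra.
Qed.

Lemma profile_slope x y r : - r <= x -> x <= y -> y <= r ->
  slope r * (y - x) <= profile y - profile x.
Proof.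
move=> rx xy yr; have [x0|x0] := leP 0 x.
  have y0 : 0 <= y by lra.
  have := inv_ln_slope x0 xy yr; rewrite /profile x0 y0.
  by move: (_^-1) (_^-1) => i j; lra.
have nx : - x <= r by lra.
have [y0|y0] := leP 0 y.
  have h1 := inv_ln_slope (lexx 0) y0 yr.
  have xn : 0 <= - x by lra.
  have h2 := inv_ln_slope (lexx 0) xn nx.
  move: h1 h2; rewrite /profile y0 (leNgt 0 x) x0/= !(addr0, ln1, invr1).
  by move: (_^-1) (_^-1) => i j; lra.
have yn : 0 <= - y by lra.
have yx : - y <= - x by lra.
have := inv_ln_slope yn yx nx.
rewrite /profile (leNgt 0 x) x0 (leNgt 0 y) y0/=.
by move: (_^-1) (_^-1) => i j; lra.
Qed.

Lemma profile_nondecreasing : {homo @profile : x y / x <= y}.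
Proof.
move=> x y xy; pose r := `|x| + `|y|.
have xr : - r <= x by rewrite /r; have := ler_norm (- x); rewrite normrN; have := normr_ge0 y; lra.
have yr : y <= r by rewrite /r; have := ler_norm y; have := normr_ge0 x; lra.
have h := profile_slope xr xy yr; rewrite -subr_ge0 (le_trans _ h)//.
by rewrite mulr_ge0 ?subr_ge0// ltW// slope_gt0// addr_ge0.
Qed.

End Profile.

(** * A set with prescribed local density *)

Section CellEstimates.
Context {R : realType}.
Notation mu := (@lebesgue_measure R).

Lemma lebesgue_itvco (a b : R) : a <= b -> mu `[a, b[%classic = (b - a)%:E.
Proof.
move=> ab; rewrite lebesgue_measure_itv/= lte_fin; case: ltP => [_|ba].
  by rewrite EFinB.
by have -> : a = b; [apply/eqP; rewrite eq_le ab|rewrite subrr].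
Qed.

Lemma Rintegral_itv_cat (u : R -> R) (x y z : R) : x <= y -> y <= z ->
  mu.-integrable `[x, z[ (EFin \o u) ->
  \int[mu]_(t in `[x, z[) u t = \int[mu]_(t in `[x, y[) u t + \int[mu]_(t in `[y, z[) u t.
Proof.
move=> xy yz; rewrite (@itv_bndbnd_setU _ _ _ (BLeft y)) ?bnd_simp// => iu.
rewrite Rintegral_setU//=; try exact: measurable_itv.
by apply/disj_setPS => t [/=]; rewrite !in_itv/= => /andP[_ ty] /andP[]; rewrite leNgt ty.
Qed.

(** On an interval where [k] has zero mean, [q] may be replaced by its
    difference with its value at the left end, of size at most [Q y - Q x]. *)
Lemma zero_mean_estimate (k q Q : R -> R) (c x y : R) : x <= y ->
  measurable_fun setT k -> (forall t, `|k t| <= 1) ->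
  \int[mu]_(t in `[x, y[) k t = 0 ->
  (forall s t, s <= t -> `|q t - q s| <= Q t - Q s /\ Q t - Q s <= c) ->
  `|\int[mu]_(t in `[x, y[) (k t * q t)| <= (y - x) * (Q y - Q x).
Proof.
move=> xy mk k1 k0 qQ.
have mD : measurable (`[x, y[%classic : set (measurableTypeR R)) by exact: measurable_itv.
have fD : (mu `[x, y[%classic < +oo)%E by exact: lebesgue_itv_lty.
have cq : controlled c q by exists Q.
have [M qM] := controlled_bounded cq.
have mq := controlled_measurable cq.
have ik : mu.-integrable `[x, y[ (EFin \o k) by apply: (bounded_integrable mD fD mk (M := 1)).
have ikq (d : R) : mu.-integrable `[x, y[ (EFin \o (fun t => k t * (q t - d))).
  apply: (bounded_integrable mD fD (M := M + `|d|)).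
    by apply: measurable_funM => //; exact: measurable_funB.
  move=> t _; rewrite normrM -[leRHS]mul1r ler_pM//.
  by rewrite (le_trans (ler_normB _ _))// lerD2r.
have -> : \int[mu]_(t in `[x, y[) (k t * q t) = \int[mu]_(t in `[x, y[) (k t * (q t - q x)).
  rewrite -[RHS]addr0 -[in RHS](mulr0 (q x)) -k0 -RintegralZl// -RintegralD//.
    by apply: eq_Rintegral => t _; ring.
  by have := integrableZl mD (q x) ik; apply: eq_integrable => // t _ /=; rewrite EFinM.
apply: (le_trans (le_normr_Rintegral mD (ikq _))).
apply: (@le_trans _ _ (\int[mu]_(t in `[x, y[) (Q y - Q x))).
  apply: le_Rintegral => //.
  - by apply: integrable_norm; exact: ikq.
  - by apply: (bounded_integrable mD fD (M := `|Q y - Q x|)) => //; exact: measurable_cst.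
  move=> t /=; rewrite in_itv/= => /andP[xt ty].
  rewrite normrM -[leRHS]mul1r ler_pM//.
  have [h1 _] := qQ _ _ xt; have [h2 _] := qQ _ _ (ltW ty).
  have := normr_ge0 (q y - q t); lra.
have muE : fine (mu `[x, y[%classic) = y - x by rewrite lebesgue_itvco.
by rewrite Rintegral_cst// [fine _]muE mulrC.
Qed.

End CellEstimates.

Section DensitySet.
Context {R : realType}.
Notation mu := (@lebesgue_measure R).
Variables (phi : R -> R) (N : nat -> nat).
Hypotheses (phi0 : forall x, 0 < phi x) (phi1 : forall x, phi x < 1).
Hypothesis ndphi : {homo phi : x y / x <= y}.
Hypothesis N0 : forall s, (0 < N s)%N.

(** Each unit interval [[n, n + 1[] is cut into [N `|n|] equal cells, which start
    at the nodes. A block is the initial part of a cell whose length is the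
    integral of the density [phi] over that cell. *)
Definition node (n : int) (j : nat) : R := n%:~R + j%:R / (N `|n|)%:R.

Definition block (n : int) (j : nat) : set R :=
  `[node n j, node n j + \int[mu]_(t in `[node n j, node n j.+1[) phi t[%classic.

Definition blocks : set (set R) :=
  [set block p.1 p.2 | p in [set p : int * nat | (p.2 < N `|p.1|)%N]].

Definition density_set : set R := \bigcup_(J in blocks) J.

Let NR0 n : 0 < (N `|n|)%:R :> R. Proof. by rewrite ltr0n. Qed.

Lemma node_step n j : node n j.+1 = node n j + (N `|n|)%:R^-1.
Proof. by rewrite /node -[j.+1%:R]natr1 mulrDl mul1r addrA. Qed.

Lemma node0 n : node n 0 = n%:~R.
Proof. by rewrite /node mul0r addr0. Qed.

Lemma nodeN n : node n (N `|n|) = (n + 1)%:~R.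
Proof. by rewrite /node divff ?lt0r_neq0// intrD. Qed.

Lemma le_node n j k : (j <= k)%N -> node n j <= node n k.
Proof. by move=> jk; rewrite lerD2l ler_pM2r ?invr_gt0// ler_nat. Qed.

Lemma cell_inj x n n' j j' : (j < N `|n|)%N -> (j' < N `|n'|)%N ->
  node n j <= x -> x < node n j.+1 -> node n' j' <= x -> x < node n' j'.+1 ->
  n = n' /\ j = j'.
Proof.
move=> jN jN' jx xj jx' xj'.
have lo m i y : node m i <= y -> m%:~R <= y.
  by apply: le_trans; rewrite -node0 le_node.
have hi m i y : (i < N `|m|)%N -> y < node m i.+1 -> y < (m + 1)%:~R.
  by move=> iN yi; rewrite (lt_le_trans yi)// -nodeN le_node.
have nn : n = n'.
  have := le_lt_trans (lo _ _ _ jx) (hi _ _ _ jN' xj').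
  have := le_lt_trans (lo _ _ _ jx') (hi _ _ _ jN xj).
  by rewrite !ltr_int; lia.
subst n'; split => //.
have := le_lt_trans jx xj'; have := le_lt_trans jx' xj.
by rewrite /node !ltrD2l !ltr_pM2r ?invr_gt0// !ltr_nat; lia.
Qed.

Let mphi : measurable_fun setT phi.
Proof. exact: nondecreasing_measurable. Qed.

Let iphi (x y : R) : mu.-integrable `[x, y[ (EFin \o phi).
Proof.
apply: (@bounded_integrable _ _ _ 1) => //; first exact: lebesgue_itv_lty.
by move=> t _; rewrite ger0_norm ltW.
Qed.

Lemma block_length_gt0 n j : 0 < \int[mu]_(t in `[node n j, node n j.+1[) phi t.
Proof.
have h : 0 < phi (node n j) * (N `|n|)%:R^-1 by rewrite mulr_gt0 ?invr_gt0.
apply: (lt_le_trans h).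
have -> : (N `|n|)%:R^-1 = fine (mu `[node n j, node n j.+1[%classic).
  by rewrite lebesgue_itvco ?le_node// node_step addrC addKr.
rewrite -Rintegral_cst; last exact: measurable_itv.
apply: le_Rintegral => //.
  by apply: (@bounded_integrable _ _ _ `|phi (node n j)|) => //; exact: lebesgue_itv_lty.
by move=> t; rewrite /= in_itv/= => /andP[nt _]; exact: ndphi.
Qed.

Lemma block_length_le n j :
  \int[mu]_(t in `[node n j, node n j.+1[) phi t <= (N `|n|)%:R^-1.
Proof.
have -> : (N `|n|)%:R^-1 = 1 * fine (mu `[node n j, node n j.+1[%classic).
  by rewrite lebesgue_itvco ?le_node// node_step addrC addKr mul1r.
rewrite -Rintegral_cst; last exact: measurable_itv.
apply: le_Rintegral => //.
  by apply: (@bounded_integrable _ _ _ 1) => //; [exact: lebesgue_itv_lty|move=> t _; rewrite normr1].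
by move=> t _; exact: ltW.
Qed.

Lemma block_sub n j : block n j `<=` `[node n j, node n j.+1[%classic.
Proof.
move=> x; rewrite /block/= !in_itv/= => /andP[-> h]/=.
by rewrite node_step (lt_le_trans h)// lerD2l block_length_le.
Qed.

Lemma density_set_cell n j x : (j < N `|n|)%N ->
  node n j <= x -> x < node n j.+1 -> density_set x <-> block n j x.
Proof.
move=> jN jx xj; split => [[_ [[n' j'] /= jN' <-] bx]|bx]; last first.
  by exists (block n j) => //; exists (n, j).
have := block_sub bx; rewrite /= in_itv/= => /andP[jx' xj'].
by have [nn jj] := cell_inj jN jN' jx xj jx' xj'; subst.
Qed.

Lemma measurable_density_set : measurable density_set.
Proof.
have -> : density_set = \bigcup_(p : int * nat)
    (if (p.2 < N `|p.1|)%N then block p.1 p.2 else set0).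
  apply/seteqP; split => [x [_ [p pN <-] bx]|x [p _]].
    by exists p => //; rewrite pN.
  by case: ifPn => // pN bx; exists (block p.1 p.2) => //; exists p.
apply: countable_bigcupT_measurable; first exact: countableP.
by move=> p; case: ifP => // _; exact: measurable_itv.
Qed.

Lemma locally_finite_density_set : locally_finite_union_itv density_set.
Proof.
exists blocks; split => //.
  move=> _ [p _ <-]; have l0 := block_length_gt0 p.1 p.2; split.
  - exact: interval_is_interval.
  - rewrite /block; move: (node _ _) (_ + _) => a b.
    exists (`|a| + `|b|); split => [|z Mz x /=]; first exact: num_real.
    rewrite in_itv/= => /andP[ax xb]; rewrite (le_trans _ (ltW Mz))// ler_norml.
    have := ler_norm (- a); have := ler_norm b; rewrite normrN.
    have := normr_ge0 a; have := normr_ge0 b; lra.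
  - exists (node p.1 p.2), (node p.1 p.2 +
      (\int[mu]_(t in `[node p.1 p.2, node p.1 p.2.+1[) phi t) / 2).
    by rewrite /block /= !in_itv/=; split; lra.
move=> I [_ [M [_ MI]] _].
have {}MI x : I x -> `|x| <= `|M| + 1.
  by apply: MI; rewrite (le_lt_trans (ler_norm M))// ltrDl.
have [k Mk] : exists k : nat, `|M| + 1 <= k%:R.
  by exists (Num.bound (`|M| + 1)); apply/ltW/archi_boundP; rewrite addr_ge0.
pose K := k.+1; have KE : K%:R = k%:R + 1 :> R by rewrite natr1.
apply: (@sub_finite_set _ _ (\bigcup_(m in `I_(K + K).+1)
    (block (m%:Z - K%:Z)%R @` `I_(N `|m%:Z - K%:Z|)))); last first.
  by apply: bigcup_finite => // m _; exact: finite_image.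
move=> J [[[n j] /= jN <-]] [x [bx /MI xM]].
have := block_sub bx; rewrite /= in_itv/= => /andP[nx xn].
have n1 : n%:~R <= K%:R :> R.
  rewrite -node0 (le_trans (le_node _ (leq0n j)))// (le_trans nx)//.
  by rewrite (le_trans (ler_norm x))// (le_trans xM)// (le_trans Mk)// KE; lra.
have n2 : - K%:R <= n%:~R :> R.
  have xn1 : x < (n + 1)%:~R by rewrite (lt_le_trans xn)// -nodeN le_node.
  have : - k%:R <= x by rewrite lerNl (le_trans _ Mk)// (le_trans _ xM)// -normrN ler_norm.
  by move: xn1; rewrite intrD KE; lra.
have nK : (- K%:Z <= n <= K%:Z)%R.
  by rewrite -!(ler_int R) intrN n2.
exists (absz (n + K%:Z)%R) => /=; first by rewrite /mkset; lia.
have -> : ((absz (n + K%:Z)%R)%:Z - K%:Z)%R = n by lia.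
by exists j.
Qed.

Let kappa x : R := \1_density_set x - phi x.

Lemma discrepancy_measurable : measurable_fun setT kappa.
Proof.
by apply: measurable_funB => //; apply: measurable_indic; exact: measurable_density_set.
Qed.

Lemma discrepancy_le1 x : `|kappa x| <= 1.
Proof.
rewrite /kappa indicE ler_norml; have := phi0 x; have := phi1 x.
by case: (_ \in _) => /=; lra.
Qed.

(** The length of each block was chosen for this. *)
Lemma discrepancy_cell n j : (j < N `|n|)%N ->
  \int[mu]_(t in `[node n j, node n j.+1[) kappa t = 0.
Proof.
move=> jN; have mD : measurable (`[node n j, node n j.+1[%classic : set (measurableTypeR R)).
  exact: measurable_itv.
have iT : mu.-integrable `[node n j, node n j.+1[ (EFin \o \1_density_set).
  apply: (@bounded_integrable _ _ _ 1) => //; first exact: lebesgue_itv_lty.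
    by apply: measurable_indic; exact: measurable_density_set.
  by move=> t _; rewrite indicE; case: (_ \in _); rewrite ?normr1 ?normr0.
rewrite RintegralB//; set c := \int[mu]_(t in _) phi t.
have cE : block n j = `[node n j, node n j + c[%classic by [].
suff -> : \int[mu]_(t in `[node n j, node n j.+1[) \1_density_set t = c by rewrite subrr.
transitivity (\int[mu]_(t in `[node n j, node n j.+1[) ((cst 1 : R -> R) \_ (block n j)) t).
  apply: eq_Rintegral => t /set_mem /=; rewrite in_itv/= => /andP[jt tj].
  have [b1 b2] := density_set_cell jN jt tj; rewrite indicE patchE.
  have -> : (t \in density_set) = (t \in block n j).
    by apply/idP/idP => /set_mem h; apply/mem_set; [exact: b1|exact: b2].
  by case: ifP.
have bE : fine (mu (block n j)) = c.
  by rewrite cE lebesgue_itvco ?lerDl ?ltW ?block_length_gt0//= addrC addKr.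
rewrite -Rintegral_mkcondr setIidr; last exact: block_sub.
have mb : measurable (block n j : set (measurableTypeR R)) by exact: measurable_itv.
by rewrite Rintegral_cst// mul1r bE.
Qed.

(** By [zero_mean_estimate] each cell contributes at most its length, hence at
    most [d], times the increase of [Q] over it; these increases add up. *)
Lemma discrepancy_estimate (n : int) (k : nat) (d c : R) (q Q : R -> R) :
  (forall m : int, n <= m < n + k%:Z -> (N `|m|)%:R^-1 <= d) ->
  (forall s t, s <= t -> `|q t - q s| <= Q t - Q s /\ Q t - Q s <= c) ->
  `|\int[mu]_(t in `[n%:~R, (n + k%:Z)%:~R[) (kappa t * q t)| <=
    d * (Q (n + k%:Z)%:~R - Q n%:~R).
Proof.
move=> Nd qQ; have cq : controlled c q by exists Q.
have [M qM] := controlled_bounded cq; have mq := controlled_measurable cq.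
have ndQ s t : s <= t -> Q s <= Q t.
  by move=> /qQ[h _]; rewrite -subr_ge0 (le_trans _ h).
have ikq x y : mu.-integrable `[x, y[ (EFin \o (fun t => kappa t * q t)).
  apply: (@bounded_integrable _ _ _ M) => //; first exact: lebesgue_itv_lty.
    by apply: measurable_funM => //; exact: discrepancy_measurable.
  by move=> t _; rewrite normrM -[leRHS]mul1r ler_pM// discrepancy_le1.
pose good x y := `|\int[mu]_(t in `[x, y[) (kappa t * q t)| <= d * (Q y - Q x).
have good_cat x y z : x <= y -> y <= z -> good x y -> good y z -> good x z.
  move=> xy yz gxy gyz; rewrite /good (Rintegral_itv_cat xy yz)//.
  rewrite (le_trans (ler_normD _ _))// (le_trans (lerD gxy gyz))//.
  lra.
have good0 x : good x x.
  by rewrite /good set_itv_ge ?bnd_simp ?ltxx// Rintegral_set0 normr0 subrr mulr0.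
have good_cells (m : int) j : n <= m < n + k%:Z -> (j <= N `|m|)%N ->
    good m%:~R (node m j).
  move=> mk; elim: j => [_|j ih jN]; first by rewrite node0.
  have jj : node m j <= node m j.+1 by exact: le_node.
  apply: (good_cat _ (node m j)) => //; [by rewrite -node0 le_node|exact/ih/ltnW|].
  have := zero_mean_estimate jj discrepancy_measurable discrepancy_le1
    (discrepancy_cell jN) qQ.
  have -> : node m j.+1 - node m j = (N `|m|)%:R^-1 by rewrite node_step addrC addKr.
  move=> h; apply: (le_trans h).
  by rewrite ler_wpM2r ?subr_ge0 ?ndQ ?Nd.
suff H i : (i <= k)%N -> good n%:~R (n + i%:Z)%:~R by exact: H.
elim: i => [_|i ih ik]; first by rewrite addr0.
have e : (n + i.+1%:Z = n + i%:Z + 1)%R by lia.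
have mk : n <= n + i%:Z < n + k%:Z by lia.
have cell := good_cells _ _ mk (leqnn _); rewrite nodeN -e in cell.
have ni : n%:~R <= (n + i%:Z)%:~R :> R by rewrite ler_int; lia.
have ii : (n + i%:Z)%:~R <= (n + i.+1%:Z)%:~R :> R by rewrite ler_int; lia.
exact: good_cat ni ii (ih (ltnW ik)) cell.
Qed.

End DensitySet.

(** * The choice of the mesh *)

Section Scales.
Context {R : realType}.

(** Both [1 + r] and [1 + ln (1 + r)], for [r = s + a * M], are at most the product
    of the corresponding quantities for [s], [a] and [M]; this separates the
    variables in [slope r]. *)
Lemma slope_lower_bound (M a s : R) : 0 <= M -> 1 <= a -> 0 <= s ->
  (2 * (1 + M) * (1 + ln (1 + M)) ^+ 2)^-1 / (a * (1 + s) ^+ 3 * (1 + ln a) ^+ 2)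
    <= slope (s + a * M).
Proof.
move=> M0 a1 s0.
have lM : 0 <= ln (1 + M) by apply: ln_ge0; lra.
have la : 0 <= ln a by apply: ln_ge0.
have aM : 0 <= a * M by rewrite mulr_ge0//; lra.
have saM : 0 <= (s * a) * M by rewrite !mulr_ge0//; lra.
have sa1 : 0 <= s * (a - 1) by rewrite !mulr_ge0//; lra.
have r1 : 1 + (s + a * M) <= a * (1 + s) * (1 + M) by lra.
have lr0 : 0 <= ln (1 + (s + a * M)) by apply: ln_ge0; lra.
have lr : 1 + ln (1 + (s + a * M)) <= (1 + s) * (1 + ln a) * (1 + ln (1 + M)).
  have ln1 : ln (1 + (s + a * M)) <= ln a + ln (1 + s) + ln (1 + M).
    by rewrite -!lnM ?posrE ?mulr_gt0 ?ler_ln ?posrE ?mulr_gt0//; lra.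
  have ls : ln (1 + s) <= s by apply: le_ln1Dx; lra.
  have sl : 0 <= s * ln a by rewrite mulr_ge0.
  have sl' : 0 <= s * ln (1 + M) by rewrite mulr_ge0.
  have sl'' : 0 <= ln a * ln (1 + M) by rewrite mulr_ge0.
  have sl3 : 0 <= s * ln a * ln (1 + M) by rewrite !mulr_ge0.
  lra.
rewrite /slope -invfM lef_pV2 ?posrE ?mulr_gt0 ?exprn_gt0 ?mulr_gt0//; try lra.
apply: (@le_trans _ _ (2 * (a * (1 + s) * (1 + M)) *
   ((1 + s) * (1 + ln a) * (1 + ln (1 + M))) ^+ 2)).
  apply: ler_pM => //; [by lra|by rewrite exprn_ge0; lra|by lra|].
  by rewrite lerXn2r ?nnegrE ?mulr_ge0//; lra.
by rewrite le_eqVlt; apply/orP; left; apply/eqP; ring.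
Qed.

Lemma expR_sqr_bound (p : R) : 0 <= p -> p ^+ 2 <= 16 * expR (p / 2).
Proof.
move=> p0; have -> : p / 2 = 2 * (p / 4) by lra.
rewrite expRM_natl; have h := expR_ge1Dx (p / 4).
have : (p / 4) ^+ 2 <= expR (p / 4) ^+ 2 by rewrite lerXn2r ?nnegrE ?expR_ge0//; lra.
rewrite !expr2; lra.
Qed.

(** Absorbs the exponent [X * p ^ (2 / 3)], with [p = q ^ 3], into half of [p] at
    the cost of a constant that depends only on [X]. *)
Lemma young_cube (X q : R) : 0 <= X -> 0 <= q -> X * q ^+ 2 <= q ^+ 3 / 2 + 4 * X ^+ 3.
Proof.
move=> X0 q0; have q2 : 0 <= q ^+ 2 by rewrite exprn_ge0.
have X3 : 0 <= X ^+ 3 by rewrite exprn_ge0.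
have q3 : 0 <= q ^+ 3 by rewrite exprn_ge0.
have [qX|qX] := leP (2 * X) q.
  have : 2 * X * q ^+ 2 <= q ^+ 3 by rewrite [q ^+ 3]exprS ler_wpM2r.
  lra.
have : X * q ^+ 2 <= X * (2 * X) ^+ 2 by rewrite ler_wpM2l// lerXn2r ?nnegrE; lra.
have -> : X * (2 * X) ^+ 2 = 4 * X ^+ 3 by ring.
lra.
Qed.

(** The main term on the right must beat both errors on the left, at every scale
    [a] and every distance [s] from the origin. With [p = 1 + ln a], the error
    [e] is a cube [z ^ 3] of order [(1 + s) ^ -3 * p ^ -2], small enough for
    [a * e] to be at most half of the main term. Then the exponent [C2 / z] is [X s * p ^ (2 / 3)],
    whereas [a] itself is [expR (p - 1)]; by [young_cube] and [expR_sqr_bound]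
    the factor that remains depends on [s] only, and [N s] is chosen above it. *)
Lemma scale_choice (c0 M C1 C2 : R) : 0 < c0 -> 0 <= M -> 0 < C1 -> 0 < C2 ->
  exists N : nat -> nat, [/\ forall s, (0 < N s)%N,
    {homo N : s t / (s <= t)%N} &
    forall (s : nat) (a : R), 1 <= a -> exists2 e, 0 < e &
      a * e + (N s)%:R^-1 * (C1 * expR (C2 * e `^ (- 3^-1)))
        < a ^+ 2 * c0 * slope (s%:R + a * M)].
Proof.
move=> c00 M0 C10 C20.
have lM : 0 <= ln (1 + M) by apply: ln_ge0; lra.
pose D := (2 * (1 + M) * (1 + ln (1 + M)) ^+ 2)^-1.
have D0 : 0 < D by rewrite invr_gt0 !mulr_gt0 ?exprn_gt0//; lra.
(* Truncating at 1 ensures [k ^ 3 <= k]. *)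
pose k := Num.min 1 (c0 * D / 2).
have k0 : 0 < k by rewrite lt_min ltr01 !mulr_gt0//= invr_gt0.
have k3 : k ^+ 3 <= c0 * D / 2.
  apply: (@le_trans _ _ k); last by rewrite ge_min lexx orbT.
  by rewrite exprS ger_pMr// exprn_ile1 ?(ltW k0)// ge_min lexx.
pose X (s : nat) := C2 * (1 + s%:R) / k.
pose B s := C1 * expR 1 * expR (4 * X s ^+ 3) * 16 * (1 + s%:R) ^+ 3 / k ^+ 3.
have s0 (s : nat) : 0 <= s%:R :> R by [].
have X0 s : 0 < X s by rewrite divr_gt0// mulr_gt0//; have := s0 s; lra.
have ndB s t : (s <= t)%N -> B s <= B t.
  move=> st; have stR : s%:R <= t%:R :> R by rewrite ler_nat.
  have sp : 0 <= 1 + s%:R :> R by have := s0 s; lra.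
  have Xst : X s ^+ 3 <= X t ^+ 3.
    rewrite lerXn2r ?nnegrE ?(ltW (X0 _))//.
    by rewrite ler_pM2r ?invr_gt0// ler_pM2l//; lra.
  rewrite ler_pM2r ?invr_gt0 ?exprn_gt0//.
  apply: ler_pM; rewrite ?exprn_ge0//.
  - by rewrite !mulr_ge0 ?expR_ge0 ?ltW.
  - by rewrite ler_pM2r// ler_pM2l ?mulr_gt0 ?expR_gt0// ler_expR; lra.
  - by rewrite lerXn2r ?nnegrE//; lra.
exists (fun s => (Num.truncn (B s)).+1); split => // [s t /ndB|s a a1].
  by move=> /le_truncn; rewrite ltnS.
have BN : B s < (Num.truncn (B s)).+1%:R by exact: truncnS_gt.
move: (_.+1) BN => N BN.
have B0 : 0 < B s.
  rewrite /B !mulr_gt0 ?expR_gt0 ?invr_gt0 ?exprn_gt0//; have := s0 s; lra.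
have N0 : 0 < N%:R :> R by exact: lt_trans BN.
have la : 0 <= ln a by apply: ln_ge0.
pose p := 1 + ln a; have p1 : 1 <= p by rewrite /p; lra.
pose q := p `^ (3^-1).
have q0 : 0 < q by apply: powR_gt0; lra.
have qp : q ^+ 3 = p.
  rewrite -powR_mulrn ?ltW// -powRrM mulVf ?powRr1//; lra.
have sp : 0 < 1 + s%:R :> R by have := s0 s; lra.
pose z := k / ((1 + s%:R) * q ^+ 2).
have z0 : 0 < z by rewrite divr_gt0 ?mulr_gt0 ?exprn_gt0.
have zE : (z ^+ 3) `^ (- 3^-1) = z^-1.
  by rewrite powRN -powR_mulrn ?ltW// -powRrM mulfV ?powRr1// ltW.
have aE : a = expR (p - 1) by rewrite /p addrC addKr lnK// posrE; lra.
have a0 : 0 < a by lra.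
have z3 : z ^+ 3 = k ^+ 3 / ((1 + s%:R) ^+ 3 * p ^+ 2).
  rewrite /z -qp expr_div_n; congr (_ / _); rewrite exprMn -!exprM mulnC//.
exists (z ^+ 3); first by rewrite exprn_gt0.
rewrite zE.
have main : N%:R^-1 * (C1 * expR (C2 * z^-1)) < a * z ^+ 3.
  have -> : C2 * z^-1 = X s * q ^+ 2 by rewrite /z invf_div /X; ring.
  rewrite ltr_pdivrMl//.
  set E4 := expR (4 * X s ^+ 3).
  have E4_0 : 0 < E4 by exact: expR_gt0.
  have E : expR (X s * q ^+ 2) <= expR (p / 2) * E4.
    by rewrite -expRD ler_expR -qp young_cube// ltW.
  have EE : expR (p / 2) * expR (p / 2) = expR 1 * a.
    by rewrite -!expRD [in RHS]aE -expRD; congr expR; lra.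
  have P := expR_sqr_bound (le_trans ler01 p1).
  have w0 : 0 < (1 + s%:R) ^+ 3 * p ^+ 2 :> R by rewrite mulr_gt0 ?exprn_gt0//; lra.
  have k30 : 0 < k ^+ 3 by rewrite exprn_gt0.
  apply: (@le_lt_trans _ _ (B s * (a * z ^+ 3))); last by rewrite ltr_pM2r// mulr_gt0// exprn_gt0.
  rewrite z3 (mulrA (B s)) (mulrA (B s * a)) ler_pdivlMr//.
  have -> : B s * a * k ^+ 3 = C1 * (expR (p / 2) * E4) * ((1 + s%:R) ^+ 3 * (16 * expR (p / 2))).
    have -> : C1 * (expR (p / 2) * E4) * ((1 + s%:R) ^+ 3 * (16 * expR (p / 2))) =
      C1 * E4 * (1 + s%:R) ^+ 3 * 16 * (expR (p / 2) * expR (p / 2)) by ring.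
    by rewrite EE /B -/E4; field; rewrite gt_eqF.
  apply: ler_pM.
  - by rewrite mulr_ge0 ?expR_ge0// ltW.
  - exact: ltW.
  - by rewrite ler_pM2l.
  - by rewrite ler_pM2l// exprn_gt0.
have : 2 * (a * z ^+ 3) <= a ^+ 2 * c0 * slope (s%:R + a * M); last by lra.
have := slope_lower_bound M0 a1 (s0 s); rewrite -/D -/p => h.
apply: (@le_trans _ _ (a ^+ 2 * c0 * (D / (a * (1 + s%:R) ^+ 3 * p ^+ 2)))); last first.
  by rewrite ler_pM2l// mulr_gt0// exprn_gt0.
have [ane sne pne] : [/\ a != 0, 1 + s%:R != 0 :> R & p != 0].
  by rewrite !gt_eqF//; lra.
have -> : a ^+ 2 * c0 * (D / (a * (1 + s%:R) ^+ 3 * p ^+ 2)) =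
    2 * (a * (c0 * D / 2 / ((1 + s%:R) ^+ 3 * p ^+ 2))).
  by field; rewrite ?ane ?sne ?pne.
rewrite z3 ler_pM2l// ler_pM2l// ler_pM2r// invr_gt0 mulr_gt0 ?exprn_gt0//; lra.
Qed.

End Scales.

(** * Integrals of increments *)

Section Increments.
Context {R : realType}.
Notation mu := (@lebesgue_measure R).

Lemma supported_integrable (u : R -> R) (B x y : R) : measurable_fun setT u ->
  (forall t, `|u t| <= B) -> (forall t, u t != 0 -> x <= t < y) ->
  mu.-integrable setT (EFin \o u).
Proof.
move=> mfu uB us.
have mD : measurable (`[x, y[%classic : set (measurableTypeR R)) by exact: measurable_itv.
have -> : EFin \o u = (EFin \o u) \_ `[x, y[.
  apply/funext => t; rewrite patchE; case: ifPn => // /negP tD /=.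
  have [->//|/us ut] := eqVneq (u t) 0; exfalso; apply: tD; apply/mem_set.
  by rewrite /= in_itv.
rewrite -integrable_mkcond//; apply: (bounded_integrable mD _ mfu (M := B)) => //.
exact: lebesgue_itv_lty.
Qed.

Lemma Rintegral_supported (u : R -> R) (x y : R) :
  (forall t, u t != 0 -> x <= t < y) ->
  \int[mu]_(t in `[x, y[) u t = \int[mu]_(t in setT) u t.
Proof.
move=> us; rewrite Rintegral_mkcond; congr (Rintegral _ _ _).
apply/funext => t; rewrite patchE; case: ifPn => // /negP tD /=.
have [->//|/us ut] := eqVneq (u t) 0; exfalso; apply: tD; apply/mem_set.
by rewrite /= in_itv.
Qed.

(** Shifting the interval of integration instead of the integrand leaves two
    short intervals at the ends, on which the values of [U] differ by at most
    its total increase. *)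
Lemma increment_integral (U : R -> R) (c x y s : R) : x <= y -> 0 <= s ->
  (forall a b, a <= b -> 0 <= U b - U a <= c) ->
  \int[mu]_(t in `[x, y[) (U (t + s) - U t) <= s * c.
Proof.
move=> xy s0 Uc.
have cU : controlled c U.
  exists U => a b ab; have /andP[h1 h2] := Uc _ _ ab; split => //.
  by rewrite ger0_norm.
have mU := controlled_measurable cU.
have iU a b : mu.-integrable `[a, b[ (EFin \o U).
  apply: (controlled_integrable cU); last exact: lebesgue_itv_lty.
  exact: measurable_itv.
have iUs d a b : mu.-integrable `[a, b[ (EFin \o (fun t => U (t + d))).
  apply: (controlled_integrable (controlled_shift d cU)); last exact: lebesgue_itv_lty.
  exact: measurable_itv.
have shift d a b : \int[mu]_(t in `[a, b[) U (t + d) =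
    \int[mu]_(t in `[a + d, b + d[) U t.
  have pE : (fun t => t + d) @^-1` `[a + d, b + d[ = `[a, b[%classic :> set R.
    by rewrite preimage_shift !addrK.
  rewrite -[in LHS]pE; apply/esym/Rintegral_shift => //.
  by rewrite pE; exact: iUs.
rewrite RintegralB//.
rewrite shift.
have e1 : \int[mu]_(t in `[x, y + s[) U t =
    \int[mu]_(t in `[x, x + s[) U t + \int[mu]_(t in `[x + s, y + s[) U t.
  by apply: Rintegral_itv_cat; rewrite ?lerD2r ?lerDl.
have e2 : \int[mu]_(t in `[x, y + s[) U t =
    \int[mu]_(t in `[x, y[) U t + \int[mu]_(t in `[y, y + s[) U t.
  by apply: Rintegral_itv_cat; rewrite ?lerDl.
have e3 : \int[mu]_(t in `[y, y + s[) U t = \int[mu]_(t in `[x, x + s[) U (t + (y - x)).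
  rewrite shift; have -> : x + (y - x) = y by ring.
  by have -> : x + s + (y - x) = y + s by ring.
have -> : \int[mu]_(t in `[x + s, y + s[) U t - \int[mu]_(t in `[x, y[) U t =
    \int[mu]_(t in `[x, x + s[) (U (t + (y - x)) - U t).
  rewrite RintegralB//.
  rewrite -e3; lra.
have mD : measurable (`[x, x + s[%classic : set (measurableTypeR R)) by exact: measurable_itv.
have xs : x <= x + s by rewrite lerDl.
have muE : fine (mu `[x, x + s[%classic) = s.
  by rewrite lebesgue_itvco//= addrC addKr.
apply: (@le_trans _ _ (\int[mu]_(t in `[x, x + s[) c)).
  apply: le_Rintegral => //.
  - have := integrableB mD (iUs (y - x) x (x + s)) (iU x (x + s)).
    by apply: eq_integrable => // t _ /=; rewrite EFinB.
  - apply: (bounded_integrable mD _ _ (M := `|c|)) => //.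
    exact: lebesgue_itv_lty.
  - move=> t _; have h : t <= t + (y - x) by lra.
    by have /andP[_] := Uc _ _ h.
by rewrite Rintegral_cst// [fine _]muE mulrC.
Qed.

(** [s] is the distance of the window to the origin: it bounds [`|m|] from below,
    hence the mesh from above, and with the length of the window it bounds
    [`|m|] from above, hence the slope from below. *)
Lemma int_window (n : int) (k : nat) : (0 < k)%N -> exists s : nat,
  [/\ forall m : int, n <= m < n + k%:Z -> (s <= `|m|)%N,
      - (s%:Z + k%:Z) <= n & n + k%:Z <= s%:Z + k%:Z].
Proof.
move=> k0; have [n0|n0] := leP 0 n.
  by exists `|n|%N; split => [m|//|//]; lia.
have [nk|nk] := leP 0 (n + k%:Z).
  by exists 0%N; split => [//||]; lia.
by exists `|(n + k%:Z)%R|%N; split => [m|//|//]; lia.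
Qed.

End Increments.

Section Decrease.
Context {R : realType}.
Notation mu := (@lebesgue_measure R).

(** A translation moves the shifts from [u] to the profile. Both shifts of the
    support of [u] lie in [[-r, r]], where the profile has slope at least
    [slope r]. *)
Lemma profile_integral_decrease (u : R -> R) (B x y r s1 s2 : R) :
  measurable_fun setT u -> (forall t, 0 <= u t <= B) -> s1 <= s2 ->
  - r <= x -> y <= r ->
  (forall t, u (t + s1) != 0 -> x <= t < y) ->
  (forall t, u (t + s2) != 0 -> x <= t < y) ->
  \int[mu]_(t in `[x, y[) (profile t * (u (t + s2) - u (t + s1))) <=
    - (slope r * (s2 - s1) * \int[mu]_t u t).
Proof.
move=> mfu uB s12 rx yr us1 us2.
have mp (c : R) : measurable_fun setT (fun t : R => profile (t + c)).
  apply: nondecreasing_measurable => // a b ab.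
  by apply: profile_nondecreasing; rewrite lerD2r.
have mus (c : R) : measurable_fun setT (fun t : R => u (t + c)).
  exact: (measurableT_comp mfu (measurable_shift c)).
have mp0 : measurable_fun setT (@profile R).
  by apply: nondecreasing_measurable => //; exact: profile_nondecreasing.
have bound (t t' : R) : `|profile t * u t'| <= B.
  have /andP[u0 uB'] := uB t'.
  rewrite normrM -[leRHS]mul1r; apply: ler_pM => //.
    by rewrite gtr0_norm ?profile_gt0// ltW// profile_lt1.
  by rewrite ger0_norm.
have shifted s : (forall t, u (t + s) != 0 -> x <= t < y) ->
    [/\ mu.-integrable setT (EFin \o (fun t => profile t * u (t + s))),
        mu.-integrable setT (EFin \o (fun t => profile (t - s) * u t)) &
    \int[mu]_(t in `[x, y[) (profile t * u (t + s)) =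
    \int[mu]_t (profile (t - s) * u t)].
  move=> us.
  have nz t : profile t * u (t + s) != 0 -> x <= t < y.
    by rewrite mulf_eq0 negb_or => /andP[_]; exact: us.
  have i1 : mu.-integrable setT (EFin \o (fun t => profile t * u (t + s))).
    apply: (@supported_integrable _ _ B x y) => //.
    exact: (measurable_funM mp0 (mus s)).
  have i2 : mu.-integrable setT (EFin \o (fun t => profile (t - s) * u t)).
    apply: (@supported_integrable _ _ B (x + s) (y + s)) => //.
      exact: (measurable_funM (mp (- s)) mfu).
    move=> t; rewrite mulf_eq0 negb_or => /andP[_ ut].
    have : x <= t - s < y by apply: us; rewrite subrK.
    lra.
  split => //.
  rewrite Rintegral_supported//.
  rewrite [RHS](@Rintegral_shift _ _ s)//.
  - by rewrite preimage_setT; apply: eq_Rintegral => t _; rewrite addrK.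
  - exact: (measurable_funM (mp (- s)) mfu).
  rewrite preimage_setT; apply: eq_integrable i1 => // t _ /=; rewrite addrK//.
have [i1 j1 e1] := shifted _ us1; have [i2 j2 e2] := shifted _ us2.
have iS k : mu.-integrable setT (EFin \o k) -> mu.-integrable `[x, y[ (EFin \o k).
  by apply: integrableS => //; exact: measurable_itv.
have -> : \int[mu]_(t in `[x, y[) (profile t * (u (t + s2) - u (t + s1))) =
   \int[mu]_(t in `[x, y[) (profile t * u (t + s2)) -
   \int[mu]_(t in `[x, y[) (profile t * u (t + s1)).
  rewrite -RintegralB//; [|exact: iS|exact: iS].
  by apply: eq_Rintegral => t _; ring.
have iu : mu.-integrable setT (EFin \o u).
  apply: (@supported_integrable _ _ B (x + s1) (y + s1)) => //.
  - by move=> t; have /andP[u0 uB'] := uB t; rewrite ger0_norm.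
  - move=> t ut; have : x <= t - s1 < y by apply: us1; rewrite subrK.
    lra.
rewrite e1 e2 -RintegralB// -mulNr -RintegralZl//.
apply: le_Rintegral => //.
- by have := integrableB measurableT j2 j1; apply: eq_integrable => // t _ /=; rewrite EFinB.
- by have := integrableZl measurableT (- (slope r * (s2 - s1))) iu; apply: eq_integrable => // t _ /=; rewrite EFinM.
move=> t _; rewrite -mulrBl.
have /andP[u0 _] := uB t; have [->|ut] := eqVneq (u t) 0; first by rewrite !mulr0.
rewrite ler_wpM2r// lerNr opprB.
have /andP[h1 h2] : x <= t - s1 < y by apply: us1; rewrite subrK.
have /andP[h3 h4] : x <= t - s2 < y by apply: us2; rewrite subrK.
have -> : s2 - s1 = (t - s1) - (t - s2) by ring.
apply: profile_slope; [exact: le_trans rx h3| |exact: le_trans (ltW h2) yr].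
by rewrite lerD2l lerN2.
Qed.

Lemma integral_bump_lower_bound (u : R -> R) (B x y c d m : R) : measurable_fun setT u ->
  (forall t, 0 <= u t <= B) -> (forall t, u t != 0 -> x <= t < y) ->
  c <= d -> (forall t, c <= t < d -> m <= u t) ->
  m * (d - c) <= \int[mu]_t u t.
Proof.
move=> mfu uB us cd um.
have iu : mu.-integrable setT (EFin \o u).
  apply: (supported_integrable mfu (B := B) _ us) => t.
  by have /andP[u0 uB'] := uB t; rewrite ger0_norm.
have mD : measurable (`[c, d[%classic : set (measurableTypeR R)) by exact: measurable_itv.
have iuD : mu.-integrable `[c, d[ (EFin \o u) by apply: integrableS iu.
have muE : fine (mu `[c, d[%classic) = d - c by rewrite lebesgue_itvco.
have <- : \int[mu]_(t in `[c, d[) m = m * (d - c) by rewrite Rintegral_cst// [fine _]muE.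
apply: (@le_trans _ _ (\int[mu]_(t in `[c, d[) u t)).
  apply: le_Rintegral => //.
    by apply: (bounded_integrable mD _ _ (M := `|m|)) => //; exact: lebesgue_itv_lty.
rewrite [leLHS]Rintegral_mkcond; apply: le_Rintegral => //.
  by rewrite -restrict_EFin -integrable_mkcond.
move=> t _; rewrite patchE; case: ifP => // _.
by have /andP[] := uB t.
Qed.

End Decrease.

(** * The comparison on a window *)

Section WindowBounds.
Context {R : realType}.

(** The bumps for all shifts between [b1] and [b2] lie in an interval of length
    [a * (2 * L + (b2 - b1))]; rounding its ends to integers adds at most 2, and
    [1 <= a]. *)
Lemma integer_window (L a b1 b2 : R) : 0 < L -> 1 <= a -> b1 < b2 -> b2 <= b1 + 1 ->
  exists (n : int) (k : nat),
    [/\ (0 < k)%N, n%:~R <= - (a * (b2 + L)), a * (L - b1) < (n + k%:Z)%:~R &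
      k%:R <= a * (2 * L + 3)].
Proof.
move=> L0 a1 b12 b21; have a0 : 0 < a by lra.
pose n := Num.floor (- (a * (b2 + L))).
pose k := absz (Num.floor (a * (L - b1)) + 1 - n)%R.
have n_le : n%:~R <= - (a * (b2 + L)) :> R by exact: floor_le.
have lt_n : - (a * (b2 + L)) < n%:~R + 1 :> R.
  by have := floorD1_gt (- (a * (b2 + L))); rewrite intrD.
have ends : - (a * (b2 + L)) < a * (L - b1).
  have -> : - (a * (b2 + L)) = a * - (b2 + L) by ring.
  by rewrite ltr_pM2l//; lra.
have kE : n + k%:Z = Num.floor (a * (L - b1)) + 1.
  have : n < Num.floor (a * (L - b1)) + 1.
    rewrite -(ltr_int R) (le_lt_trans n_le)// (lt_trans ends)//.
    exact: floorD1_gt.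
  rewrite /k; move: (Num.floor _ + 1)%R => m nm.
  by rewrite gez0_abs ?subr_ge0 ?ltW// addrC subrK.
have gt_m : a * (L - b1) < (n + k%:Z)%:~R by rewrite kE; exact: floorD1_gt.
have m_le : (n + k%:Z)%:~R <= a * (L - b1) + 1 by rewrite kE intrD lerD2r floor_le.
exists n, k; split => //.
  rewrite -(ltr_nat R); have : n%:~R < (n + k%:Z)%:~R :> R.
    by rewrite (le_lt_trans n_le)// (lt_trans ends).
  by rewrite intrD ltrDl.
have nkE : (n + k%:Z)%:~R = n%:~R + k%:R :> R by rewrite intrD.
have at1 : a * (b2 - b1) <= a * 1 by rewrite ler_pM2l//; lra.
by move: m_le lt_n at1; rewrite nkE; lra.
Qed.

Lemma support_in_window (L a b b1 b2 x y z : R) : 0 < a -> b1 <= b <= b2 ->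
  x <= - (a * (b2 + L)) -> a * (L - b1) < y -> - L < z / a + b < L -> x <= z < y.
Proof.
move=> a0 /andP[bb1 bb2] xl yr /andP[zl zr].
have h1 : - (L + b) * a < z by rewrite -ltr_pdivlMr//; lra.
have h2 : z < (L - b) * a by rewrite -ltr_pdivrMr//; lra.
have h3 : a * b <= a * b2 by rewrite ler_pM2l.
have h4 : a * b1 <= a * b by rewrite ler_pM2l.
lra.
Qed.

End WindowBounds.

Section Window.
Context {R : realType}.
Notation mu := (@lebesgue_measure R).
Variables (f : R -> R) (L B x0 rho eta C1 C2 : R) (N : nat -> nat).
Hypotheses (f_ge0 : forall x, 0 <= f x) (f_leB : forall x, f x <= B).
Hypothesis mf : measurable_fun setT f.
Hypotheses (L0 : 0 < L) (fL : forall x, f x != 0 -> - L < x < L).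
Hypothesis rho0 : 0 < rho.
Hypothesis f_bump : forall x, x0 - rho <= x < x0 + rho -> eta <= f x.
Hypothesis f_decomposition : forall e, 0 < e ->
  exists G : R -> R, controlled e (fun x => f x - G x) /\
    forall t, 0 <= t ->
      controlled (t * (C1 * expR (C2 * e `^ (- 3^-1)))) (fun x => G (x + t) - G x).
Hypotheses (N0 : forall s, (0 < N s)%N) (Nmono : {homo N : s t / (s <= t)%N}).
Hypothesis N_scale : forall (s : nat) (a : R), 1 <= a -> exists2 e, 0 < e &
  a * e + (N s)%:R^-1 * (C1 * expR (C2 * e `^ (- 3^-1)))
    < a ^+ 2 * (2 * rho * eta) * slope (s%:R + a * (2 * L + 3)).

Let T := density_set (@profile R) N.
Let kappa x : R := \1_T x - profile x.

Let mT : measurable T.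
Proof. exact: measurable_density_set. Qed.

Let mkappa : measurable_fun setT kappa.
Proof.
by apply: discrepancy_measurable => //; exact: profile_nondecreasing.
Qed.

Let kappa_le1 x : `|kappa x| <= 1.
Proof.
by apply: discrepancy_le1; [exact: profile_gt0|exact: profile_lt1].
Qed.

(** Let [u] be the bump [f (x / a)]. On the window from [x] to [y], which contains the
    supports of [u (z + s1)] and [u (z + s2)], the indicator of [T] is the profile
    plus the discrepancy [kappa], and [u (z + s2) - u (z + s1)] is the increment
    [q] of [G] plus the increment [v] of [w = f - G]. The profile gives the
    decrease [I1], and [kappa] tested against [q] and [v] gives the errors [I2]
    and [I3]. The restriction [b2 <= b1 + 1] keeps the window of length at most
    a constant times [a]. *)
Lemma window_decrease (a b1 b2 : R) : 1 <= a -> b1 < b2 -> b2 <= b1 + 1 ->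
  (\int[mu]_(x in T) (f (x / a + b2)%R)%:E < \int[mu]_(x in T) (f (x / a + b1)%R)%:E)%E.
Proof.
move=> a1 b12 b21; have a0 : 0 < a by lra.
have [hL hrho] : 0 < L /\ 0 < rho by [].
have M0 : 0 <= 2 * L + 3 by lra.
have bump_le : x0 - rho <= x0 + rho by lra.
pose u x := f (x / a); pose s1 := a * b1; pose s2 := a * b2; pose t := b2 - b1.
have t0 : 0 < t by rewrite /t; lra.
have s12 : s2 - s1 = a * t by rewrite /s1 /s2 /t; ring.
have ane : a != 0 by rewrite gt_eqF.
have uE b x : f (x / a + b) = u (x + a * b).
  by rewrite /u mulrDl [a * b]mulrC mulfK.
have [n [k [k0 n_le gt_m kR]]] := integer_window hL a1 b12 b21.
have [s [sN sn sm]] := int_window n k0.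
have [e e0 Ne] := N_scale s a1.
have [G [[W fGW] GQ]] := f_decomposition e0.
set V := C1 * expR _ in Ne GQ.
pose x := n%:~R : R; pose y := (n + k%:Z)%:~R : R; pose r := s%:R + a * (2 * L + 3).
have xy : x <= y by rewrite ler_int lerDl.
have rx : - r <= x.
  have : (- (s%:Z + k%:Z))%:~R <= x by rewrite ler_int.
  by rewrite intrN intrD /r; move: kR => /=; lra.
have yr : y <= r.
  have : y <= (s%:Z + k%:Z)%:~R by rewrite ler_int.
  by rewrite intrD /r; move: kR => /=; lra.
have mscale : measurable_fun setT (fun x : R => x / a) by exact: measurable_funM.
have mu' : measurable_fun setT u by exact: (measurableT_comp mf mscale).
have uB z : 0 <= u z <= B by rewrite f_ge0 f_leB.
have us b z : b1 <= b <= b2 -> u (z + a * b) != 0 -> x <= z < y.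
  by move=> bb; rewrite -uE => /fL; exact: support_in_window n_le gt_m.
have us1 z : u (z + s1) != 0 -> x <= z < y by apply: us; rewrite lexx ltW.
have us2 z : u (z + s2) != 0 -> x <= z < y by apply: us; rewrite lexx ltW.
have mD : measurable (`[x, y[%classic : set (measurableTypeR R)) by exact: measurable_itv.
have Dfin : (mu `[x, y[%classic < +oo)%E by exact: lebesgue_itv_lty.
(* Only the window contributes, and all integrals over it are finite. *)
have FE b : (forall z, u (z + a * b) != 0 -> x <= z < y) ->
    (\int[mu]_(z in T) (f (z / a + b)%R)%:E)%E =
    (\int[mu]_(z in `[x, y[) (\1_T z * u (z + a * b)))%:E.
  move=> ub; rewrite /Rintegral fineK.
    rewrite [LHS]integral_mkcond [RHS]integral_mkcond; congr (integral _ _ _); apply/funext => z.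
    rewrite !patchE indicE uE; case: (z \in T); case: ifPn => zD;
      rewrite ?mul1r ?mul0r//=.
    have [->//|/ub zxy] := eqVneq (u (z + a * b)) 0.
    by move/negP : zD; case; apply/mem_set; rewrite /= in_itv.
  apply: integrable_fin_num => //.
  apply: (bounded_integrable mD Dfin (M := B)).
    apply: measurable_funM; first by apply: measurable_indic.
    exact: (measurableT_comp mu' (measurable_shift _)).
  move=> z _; have /andP[u0 uB'] := uB (z + a * b).
  rewrite indicE; case: (_ \in _); rewrite ?mul1r ?mul0r ?normr0 ?ger0_norm//.
  exact: le_trans uB'.
rewrite !FE// lte_fin -subr_lt0.
pose w z := f z - G z.
pose q z := G ((z + s1) / a + t) - G ((z + s1) / a).
pose v z := w ((z + s2) / a) - w ((z + s1) / a).
(* A shift by [s2 - s1 = a * t] of the bump is a shift by [t] of [f]. *)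
have shiftE z : (z + s2) / a = (z + s1) / a + t.
  by rewrite -(subrK s1 s2) s12; field.
have uqv z : u (z + s2) - u (z + s1) = q z + v z.
  by rewrite /q /v /w -shiftE /u; ring.
have cq : controlled (t * V) q.
  exact: (controlled_shift s1 (controlled_scale a0 (GQ _ (ltW t0)))).
have [Q qQ] := cq; have mq := controlled_measurable cq.
have [Mq qM] := controlled_bounded cq.
have cw : controlled e w by exists W.
have [Mw wM] := controlled_bounded cw; have mw := controlled_measurable cw.
have msc c : measurable_fun setT (fun z : R => (z + c) / a).
  exact: (measurableT_comp mscale (measurable_shift c)).
have mv : measurable_fun setT v.
  by apply: measurable_funB; [exact: (measurableT_comp mw (msc s2))|exact: (measurableT_comp mw (msc s1))].
have vM z : `|v z| <= Mw + Mw.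
  by rewrite (le_trans (ler_normB _ _))// lerD.
have mus c : measurable_fun setT (fun z : R => u (z + c)).
  exact: (measurableT_comp mu' (measurable_shift c)).
have uM z : `|u z| <= B by have /andP[u0 uB'] := uB z; rewrite ger0_norm.
have integrable_mul (g1 g2 : R -> R) M1 : measurable_fun setT g1 ->
    measurable_fun setT g2 -> (forall z, `|g1 z| <= 1) -> (forall z, `|g2 z| <= M1) ->
    mu.-integrable `[x, y[ (EFin \o (fun z => g1 z * g2 z)).
  move=> mg1 mg2 g1M g2M; apply: (bounded_integrable mD Dfin (M := M1)).
    exact: measurable_funM.
  by move=> z _; rewrite normrM -[leRHS]mul1r ler_pM.
have mind : measurable_fun setT (\1_T : R -> R) by exact: measurable_indic.
have ind1 z : `|\1_T z : R| <= 1.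
  by rewrite indicE; case: (_ \in _); rewrite ?normr1 ?normr0.
have mprof : measurable_fun setT (@profile R).
  by apply: nondecreasing_measurable => //; exact: profile_nondecreasing.
have prof1 (z : R) : `|profile z| <= 1 by rewrite gtr0_norm ?profile_gt0// ltW// profile_lt1.
have duM z : `|u (z + s2) - u (z + s1)| <= B + B.
  by rewrite (le_trans (ler_normB _ _))// lerD.
have mdu : measurable_fun setT (fun z : R => u (z + s2) - u (z + s1)).
  exact: measurable_funB.
have -> : \int[mu]_(z in `[x, y[) (\1_T z * u (z + s2)) -
    \int[mu]_(z in `[x, y[) (\1_T z * u (z + s1)) =
    \int[mu]_(z in `[x, y[) (profile z * (u (z + s2) - u (z + s1))) +
    (\int[mu]_(z in `[x, y[) (kappa z * q z) + \int[mu]_(z in `[x, y[) (kappa z * v z)).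
  rewrite -RintegralB//; [|exact: integrable_mul|exact: integrable_mul].
  rewrite -[X in _ = _ + X]RintegralD//; [|exact: integrable_mul|exact: integrable_mul].
  rewrite -RintegralD//; [|exact: integrable_mul|].
    by apply: eq_Rintegral => z _; rewrite -mulrBr -mulrDr -uqv /kappa; ring.
  have := integrableD mD (integrable_mul _ _ _ mkappa mq kappa_le1 qM)
    (integrable_mul _ _ _ mkappa mv kappa_le1 vM).
  by apply: eq_integrable => // z _ /=; rewrite EFinD.
have I1 := fun h => profile_integral_decrease mu' uB h rx yr us1 us2.
have I2 : `|\int[mu]_(z in `[x, y[) (kappa z * q z)| <= (N s)%:R^-1 * (t * V).
  apply: (@le_trans _ _ ((N s)%:R^-1 * (Q y - Q x))).
    apply: (discrepancy_estimate (@profile_gt0 R) (@profile_lt1 R)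
      (@profile_nondecreasing R) N0 _ qQ).
    move=> m /sN sm'; rewrite lef_pV2 ?posrE ?ltr0n ?N0//.
    by rewrite ler_nat Nmono.
  by rewrite ler_wpM2l ?invr_ge0//; have [_] := qQ _ _ xy.
have I3 : `|\int[mu]_(z in `[x, y[) (kappa z * v z)| <= (s2 - s1) * e.
  have Wc c d : c <= d -> 0 <= W ((d + s1) / a) - W ((c + s1) / a) <= e.
    move=> cd; have cda : (c + s1) / a <= (d + s1) / a.
      by rewrite ler_pM2r ?invr_gt0// lerD2r.
    have [h1 h2] := fGW _ _ cda; rewrite h2 andbT.
    exact: le_trans h1.
  have s21 : 0 <= s2 - s1 by rewrite s12 mulr_ge0// ltW.
  apply: le_trans (increment_integral xy s21 Wc).
  have ikv : mu.-integrable `[x, y[ (EFin \o (fun z => kappa z * v z)) by exact: integrable_mul.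
  apply: (le_trans (le_normr_Rintegral mD ikv)).
  apply: le_Rintegral => //; first exact: integrable_norm.
    have cW : controlled e (fun z => W ((z + s1) / a)).
      by exists (fun z => W ((z + s1) / a)) => c d /Wc /andP[h1 h2]; rewrite ger0_norm.
    have := integrableB mD (controlled_integrable (controlled_shift (s2 - s1) cW) mD Dfin)
      (controlled_integrable cW mD Dfin).
    by apply: eq_integrable => // z _ /=; rewrite EFinB.
  move=> z _; rewrite normrM -[leRHS]mul1r; apply: ler_pM => //.
  rewrite -addrA subrK.
  have h : (z + s1) / a <= (z + s2) / a by rewrite shiftE lerDl ltW.
  by have [] := fGW _ _ h.
have Iu : eta * (a * (x0 + rho) - a * (x0 - rho)) <= \int[mu]_z u z.
  apply: (@integral_bump_lower_bound _ u B (a * - L) (a * L)) => //.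
  - move=> z /fL /andP[zl zr]; apply/andP; split.
      by rewrite mulrC -ler_pdivlMr// ltW.
    by rewrite mulrC -ltr_pdivrMr.
  - by rewrite ler_pM2l.
  - move=> z /andP[zl zr]; apply: f_bump.
    by rewrite ler_pdivlMr// ltr_pdivrMr// mulrC zl mulrC zr.
have sl0 : 0 < slope r.
  by apply: slope_gt0; rewrite /r addr_ge0// mulr_ge0// ltW.
have s12' : s1 <= s2 by rewrite -subr_ge0 s12 mulr_ge0// ltW.
have {}I1 := I1 s12'.
have J1 : slope r * (s2 - s1) * (eta * (a * (x0 + rho) - a * (x0 - rho))) <=
    slope r * (s2 - s1) * \int[mu]_z u z.
  by rewrite ler_wpM2l// mulr_ge0 ?subr_ge0// ltW.
have J2 : t * (a * e + (N s)%:R^-1 * V) < t * (a ^+ 2 * (2 * rho * eta) * slope r).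
  by rewrite ltr_pM2l.
have J3 : t * (a ^+ 2 * (2 * rho * eta) * slope r) =
    slope r * (s2 - s1) * (eta * (a * (x0 + rho) - a * (x0 - rho))).
  by rewrite s12; ring.
move: I2 I3; rewrite !ler_norml => /andP[_ I2] /andP[_ I3].
apply: le_lt_trans (lerD I1 (lerD I2 I3)) _.
rewrite addrC subr_lt0; apply: lt_le_trans J1; rewrite -J3.
have -> : (N s)%:R^-1 * (t * V) + (s2 - s1) * e = t * (a * e + (N s)%:R^-1 * V).
  by rewrite s12; ring.
exact: J2.
Qed.

End Window.

(** * The theorem *)

Lemma Kvar_decomposition (R : realType) (f h : R -> R) (e V : R) :
  lebesgue_measure.-integrable setT (EFin \o h) ->
  (forall x, f x = \int[lebesgue_measure]_(t in `]-oo, x]) h t) ->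
  (Kvar e (derive1 f) < V%:E)%E ->
  exists G : R -> R, controlled e (fun x => f x - G x) /\
    forall t, 0 <= t -> controlled (t * V) (fun x => G (x + t) - G x).
Proof.
move=> ih fE /ereal_inf_lt[_ [g [mg _ fg] <-] gV].
exact: variation_decomposition ih fE mg (ltW gV) fg.
Qed.

(* [derive1 f] is the pointwise derivative; where [f] is not differentiable (a null
   set, as [f] is absolutely continuous) it takes an irrelevant value.
   [strict_monotonic] is: strictly increasing or strictly decreasing. *)
Theorem theorem4p1 (R : realType) (f : R -> R)
  (f_ge0 : forall x, 0 <= f x)
  (f_neq0 : exists x, f x != 0)
  (f_cs : compactly_supported f)
  (f_ac : abs_continuous f)
  (f_K : exists C1 C2 : R, forall eps : R, 0 < eps ->
     (Kvar eps (derive1 f) <= (C1 * expR (C2 * eps `^ (- 3^-1)))%:E)%E) :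
  exists T : set R,
    [/\ measurable T,
        locally_finite_union_itv T &
        forall a : R, 1 <= a ->
          strict_monotonic [set: R] (fun b : R =>
            (\int[lebesgue_measure]_(x in T) (f (x / a + b))%:E)%E)].
Proof.
have cf := abs_continuous_continuous f_ac.
have mf : measurable_fun setT f by exact: continuous_measurable_fun.
have [L L0 fL] := compactly_supported_itv f_cs.
have f_supp x : f x != 0 -> - L < x < L.
  by apply: contra_neqT; rewrite -ltr_norml -leNgt; exact: fL.
have [h [ih fE]] := abs_continuous_indefinite_integral f_cs f_ac.
have [B fB] : exists B, forall x, f x <= B.
  have [||c _ fc] := @EVT_max R f (- L) L; first by lra.
    exact: continuous_subspaceT.
  exists (f c) => x; have [->//|/f_supp xL] := eqVneq (f x) 0.
  by apply: fc; rewrite in_itv/=; lra.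
have [x0 fx0] := f_neq0.
have fx0_gt0 : 0 < f x0 by rewrite lt_neqAle eq_sym fx0 f_ge0.
pose eta := f x0 / 2; have eta0 : 0 < eta by rewrite /eta; lra.
have [rho rho0 f_bump] : exists2 rho, 0 < rho &
    forall x, x0 - rho <= x < x0 + rho -> eta <= f x.
  have : \forall x \near x0, eta < f x.
    by apply: (cvgr_gt _ (cf x0)); rewrite /eta; lra.
  move=> /nbhs_ballP[r /= r0 rP]; exists (r / 2) => [|x xr]; first by lra.
  by apply/ltW/rP; rewrite /ball/= ltr_distl; lra.
have [C1 [C2 fK]] := f_K.
(* Larger, positive constants make the bound on [K] strict, so that some
   competitor in the infimum satisfies it. *)
pose D1 := `|C1| + 1; pose D2 := `|C2| + 1.
have D10 : 0 < D1 by rewrite /D1; have := normr_ge0 C1; lra.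
have D20 : 0 < D2 by rewrite /D2; have := normr_ge0 C2; lra.
have decomposition e : 0 < e -> exists G : R -> R,
    controlled e (fun x => f x - G x) /\
    forall t, 0 <= t ->
      controlled (t * (D1 * expR (D2 * e `^ (- 3^-1)))) (fun x => G (x + t) - G x).
  move=> e0; apply: (Kvar_decomposition ih fE); apply: le_lt_trans (fK _ e0) _.
  rewrite lte_fin; have p0 : 0 < e `^ (- 3^-1) by exact: powR_gt0.
  apply: (@le_lt_trans _ _ (`|C1| * expR (D2 * e `^ (- 3^-1)))).
    apply: (@le_trans _ _ (`|C1| * expR (C2 * e `^ (- 3^-1)))).
      by rewrite ler_wpM2r ?expR_ge0// ler_norm.
    rewrite ler_wpM2l// ler_expR ler_pM2r// /D2.
    by have := ler_norm C2; lra.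
  by rewrite ltr_pM2r ?expR_gt0// /D1 ltrDl.
have c00 : 0 < 2 * rho * eta by rewrite !mulr_gt0.
have M0 : 0 <= 2 * L + 3 by lra.
have [N [N0 Nmono Nscale]] := scale_choice c00 M0 D10 D20.
exists (density_set (@profile R) N); split.
- exact: measurable_density_set.
- apply: locally_finite_density_set => //;
    [exact: profile_gt0|exact: profile_lt1|exact: profile_nondecreasing].
move=> a a1; right.
pose F b := (\int[lebesgue_measure]_(x in density_set (@profile R) N) (f (x / a + b)%R)%:E)%E.
have dec1 b1 b2 : b1 < b2 -> b2 <= b1 + 1 -> (F b2 < F b1)%E.
  exact: (window_decrease f_ge0 fB mf L0 f_supp rho0 f_bump decomposition).
(* Longer steps are chains of steps of length at most 1. *)
have dec n : forall b1 b2, b1 < b2 -> b2 <= b1 + n%:R + 1 -> (F b2 < F b1)%E.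
  elim: n => [|n ih' ] b1 b2 b12; first by rewrite addr0; exact: dec1.
  move=> b2n; have [le1|gt1] := leP b2 (b1 + 1); first exact: dec1.
  apply: (@lt_trans _ _ (F (b1 + 1))); last by apply: dec1; lra.
  by apply: ih' => //; move: b2n; rewrite -natr1; lra.
move=> b2 b1 _ _ b12.
apply: (dec (Num.bound (b2 - b1))) => //.
have d0 : 0 <= b2 - b1 by rewrite subr_ge0 ltW.
have := archi_boundP d0; lra.
Qed.
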